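(* Let $f,g\in\mathcal{A}$, and assume that $J(f)>0$. Then $J$ is differentiable at $f$ along $g$ (that is, the limit defining $\delta J(f,g)$ exists, possibly equal to $+\infty$), and $$\delta J(f,g)\in[-k,+\infty],\qquad\text{where } k:=[\inf(-\log g)]_+\,J(f).$$ In dimension $n=1$, the same conclusions continue to hold also when $J(f)=0$.
   Context: Fix $n\ge 1$. For a convex function $u:\mathbb{R}^n\to\mathbb{R}\cup\{+\infty\}$, $\mathrm{dom}(u)=\{x: u(x)\in\mathbb{R}\}$ and $u$ is proper if $\mathrm{dom}(u)\ne\emptyset$. $\mathcal{L}$ is the set of proper convex $u:\mathbb{R}^n\to\mathbb{R}\cup\{+\infty\}$ with $\lim_{\|x\|\to+\infty}u(x)=+\infty$, and $\mathcal{A}=\{e^{-u}: u\in\mathcal{L}\}$ (with $e^{-\infty}=0$, and $-\log 0=+\infty$). Operations: $u\Box v(x)=\inf_{y\in\mathbb{R}^n}\{u(x-y)+v(y)\}$; $(u\alpha)(x)=\alpha u(x/\alpha)$ for $\alpha>0$, and $u0=I_{\{0\}}$ (equal to $0$ at the origin and $+\infty$ elsewhere). For $f=e^{-u}$, $g=e^{-v}$ in $\mathcal{A}$ and $t\ge0$, $f\oplus t\cdot g=e^{-[u\Box(vt)]}$. $J(f)=\int_{\mathbb{R}^n}f\,dx\in[0,+\infty)$ and $\delta J(f,g)=\lim_{t\to0^+}\frac{J(f\oplus t\cdot g)-J(f)}{t}$ whenever this limit exists. $[s]_+=\max\{s,0\}$. *)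

(* Defs.v *)
From HB Require Import structures.
From mathcomp Require Import all_boot all_order all_algebra.
From mathcomp Require Import all_classical all_reals all_analysis.

Set Implicit Arguments.
Unset Strict Implicit.
Unset Printing Implicit Defensive.

Import Order.TTheory GRing.Theory Num.Theory.
Import numFieldNormedType.Exports.

Local Open Scope classical_set_scope.
Local Open Scope ring_scope.
Local Open Scope ereal_scope.

(* Lebesgue measure on R^n.  The library has it only for n = 1.  We iterate the
   product measure on n-tuples, whose sigma-algebra is the product (i.e. Borel)
   one, and then complete the result: an extended-valued convex function is
   arbitrary on the boundary of its domain, hence Lebesgue measurable but not
   always Borel measurable. *)
Section lebesgue_measure_Rn.
Variable R : realType.

Local Notation Rtuple n := (n.-tuple (measurableTypeR R)).

Definition tcons n (p : Rtuple n * measurableTypeR R) : Rtuple n.+1 :=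
  [the n.+1.-tuple _ of p.2 :: p.1].

Lemma measurable_tcons n : measurable_fun [set: _] (@tcons n).
Proof. exact: measurable_cons. Qed.

Section step.
Variables (n : nat) (m : {measure set (Rtuple n) -> \bar R}).

Definition product_step : set (Rtuple n.+1) -> \bar R :=
  pushforward (m \x @lebesgue_measure R) (@tcons n).

Let step_measure : {measure set (Rtuple n.+1) -> \bar R} :=
  measure_function_pushforward__canonical__measure_function_Measure
    (m \x @lebesgue_measure R) (@measurable_tcons n).

Let product_step0 : product_step set0 = 0.
Proof. exact: (measure0 step_measure). Qed.

Let product_step_ge0 A : 0 <= product_step A.
Proof. exact: (measure_ge0 step_measure). Qed.

Let product_step_sigma_additive : semi_sigma_additive product_step.
Proof. exact: (@measure_semi_sigma_additive _ _ _ step_measure). Qed.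

HB.instance Definition _ := isMeasure.Build _ _ _ product_step
  product_step0 product_step_ge0 product_step_sigma_additive.

End step.

Fixpoint borel_lebesgue_Rn n : {measure set (Rtuple n) -> \bar R} :=
  match n with
  | 0 => \d_ ([tuple] : Rtuple 0)
  | k.+1 => product_step (borel_lebesgue_Rn k)
  end.

Definition lebesgue_Rn n :=
  @completed_measure_extension _ (Rtuple n) R (borel_lebesgue_Rn n).

Arguments lebesgue_Rn : clear implicits.

HB.instance Definition _ n := Measure.on (lebesgue_Rn n).

Definition integral_Rn n (f : 'rV[R]_n -> \bar R) : \bar R :=
  \int[lebesgue_Rn n]_t f (\row_(i < n) tnth t i)%R.

End lebesgue_measure_Rn.

Section log_concave_functions.
Variables (R : realType) (n : nat).
Local Notation Rn := 'rV[R]_n.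
Implicit Types (u v f g : Rn -> \bar R) (x y : Rn) (t a : R).

(* The norm of the library on row vectors is the sup norm. *)
Definition euclid_norm x : R := Num.sqrt (\sum_(i < n) x ord0 i ^+ 2)%R.

Definition dom u : set Rn := [set x | u x \is a fin_num].

Definition convex_fun u := forall x y a, (0 < a < 1)%R ->
  u (a *: x + (1 - a) *: y)%R <= a%:E * u x + (1 - a)%:E * u y.

Definition cvg_pinfty_at_infty u := forall M : R, exists r : R,
  forall x, (r < euclid_norm x)%R -> M%:E < u x.

Definition classL : set (Rn -> \bar R) := [set u |
  [/\ forall x, -oo < u x, dom u !=set0, convex_fun u & cvg_pinfty_at_infty u]].

Definition classA : set (Rn -> \bar R) :=
  [set (fun x => expeR (- u x)) | u in classL].

(* [lne 0 = -oo], so this is +oo where f vanishes. *)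
Definition neglog f : Rn -> \bar R := fun x => - lne (f x).

Definition infconv u v : Rn -> \bar R :=
  fun x => ereal_inf [set u (x - y)%R + v y | y in setT].

Definition indic0 : Rn -> \bar R := fun x => if x == 0%R then 0 else +oo.

(* Meaningful for a >= 0 only. *)
Definition rscale u a : Rn -> \bar R :=
  if a == 0%R then indic0 else fun x => a%:E * u (a^-1 *: x)%R.

Definition oplus f t g : Rn -> \bar R :=
  fun x => expeR (- infconv (neglog f) (rscale (neglog g) t) x).

Definition J f : \bar R := integral_Rn f.

Definition J_quotient f g t : \bar R := (J (oplus f t g) - J f) * (t^-1)%:E.

Definition J_differentiable f g := cvg (J_quotient f g t @[t --> 0%R^'+]).

Definition deltaJ f g : \bar R := lim (J_quotient f g t @[t --> 0%R^'+]).

Definition pos_part (s : \bar R) : \bar R := maxe s 0.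

Definition kJ f g : \bar R := pos_part (ereal_inf (range (neglog g))) * J f.

End log_concave_functions.

(* Main.v *)
Require Import Defs.
From HB Require Import structures.
From mathcomp Require Import all_boot all_order all_algebra.
From mathcomp Require Import all_classical all_reals all_analysis.
From mathcomp Require Import measurable_realfun.
From mathcomp Require Import ring lra.
Set Implicit Arguments.
Unset Strict Implicit.
Unset Printing Implicit Defensive.
Import Order.TTheory GRing.Theory Num.Theory.
Import numFieldNormedType.Exports.
Local Open Scope classical_set_scope.
Local Open Scope ring_scope.
Local Open Scope ereal_scope.

(** Write [f = e^-u], [g = e^-v] and [j t] for the total mass of [f (+) t.g].

    Suppose first that [0 < J f].  The function
      [(x, t) |-> inf_w (u (x - t w) + t v w)],
    which is [u] at [t = 0] and [- ln (f (+) t.g)] for [t > 0], is jointly convex,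
    so by the Prekopa-Leindler inequality [j] is log-concave on
    [0, +oo[ ([pert_mass_log_concave]).  Since [J f] is finite ([J_lty]: a
    coercive convex function grows linearly), the slopes
    [(ln (j t) - ln (j 0)) / t] increase when [t] decreases to 0 and have a limit
    [L], possibly [+oo]; hence [(j t - j 0) / t] tends to [L * J f]
    ([log_concave_right_derivative]), whether or not [j] is continuous at 0.
    Choosing one [w] in the infimum gives [e^(- t v w) * J f <= j t]
    ([pert_mass_ge], by translation invariance), so [- v w <= L] for every [w],
    and therefore [- inf v <= L].

    If [n = 1] and [J f = 0], then [u] is finite at a single point [x0], and
    [f (+) t.g] is, up to the factor [e^(- u x0)], the function [g (./t)^t]
    centred at [x0].  As [t] tends to 0 its mass divided by [t] tends to the
    length of the domain of [v] ([null_mass_limit]); this limit is nonnegative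
    and [k = 0].

    Convex functions are only handled through lower integrals: the integral
    of any nonnegative function is a supremum over measurable functions below it.  For the completed Lebesgue
    measure these may be taken Borel ([J_approx]).  The Prekopa-Leindler
    inequality is proved for Borel functions, by induction on the dimension from
    the inequality [|A + B| >= |A| + |B|] on the line, and it is transferred to
    log-concave functions through their lower semicontinuous envelopes.  The
    envelope is Borel and has the same integral as the log-concave function
    [f] itself ([integral_le_lower_envelope]): this too follows from
    Prekopa-Leindler, applied to a Borel [phi <= f], the indicator of a small cube
    on which [f] is bounded below, and the weights [1 - l] and [l], with [l]
    tending to 0.

    Hypotheses and conclusions of Prekopa-Leindler type are expressed with
    thresholds ([e^a < f x] and [e^b < g y] imply
    [e^((1 - l) a + l b) <= h ((1 - l) x + l y)]).  This avoids products of powers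
    of extended reals, and lets infinite values and infinite integrals need no
    separate treatment. *)

(** * Integrals for a completed measure are lower integrals over the original one *)

Section lower_integral.
Context d (T : measurableType d) (R : realType).
Variable mu : {measure set T -> \bar R}.
Hypothesis sfin : sigma_finite setT mu.
Local Notation cmu := (@completed_measure_extension _ T R mu).
Local Notation mue := (mu^*)%mu.

Lemma measurable_hull (A : set T) :
  exists H, [/\ measurable H, A `<=` H & mu H = mue A].
Proof.
have [Ay|Afin] := eqVneq (mue A) +oo.
  exists setT; split => //; apply/eqP; rewrite Ay -leye_eq -Ay.
  by rewrite -(measurable_mu_extE mu measurableT) le_mu_ext.
have Af : mue A \is a fin_num by rewrite ge0_fin_numE ?mu_ext_ge0// lt_neqAle Afin leey.
have inv0 k : (0 < k.+1%:R^-1 :> R)%R by rewrite invr_gt0.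
have HF k : exists F : set T, [/\ measurable F, A `<=` F & mu F <= mue A + (k.+1%:R^-1)%:E].
  have [_ [G [mG AG] <-] lt] := lb_ereal_inf_adherent (inv0 k) Af.
  exists (\bigcup_n G n); split => //; first exact: bigcupT_measurable.
  apply/ltW/(le_lt_trans _ lt); apply: measure_sigma_subadditive => //.
  exact: bigcupT_measurable.
have [F HF'] := choice HF.
exists (\bigcap_k F k); split.
- by apply: bigcapT_measurable => k; case: (HF' k).
- by move=> x Ax k _; case: (HF' k) => _ + _; exact.
apply/eqP; rewrite eq_le; apply/andP; split.
  apply/lee_addgt0Pr => e e0.
  have [k ke] : exists k, (k.+1%:R^-1 < e)%R.
    have [k _ +] := near_infty_natSinv_lt (PosNum e0).
    by move=> /(_ k (leqnn k)); exists k.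
  have [mF _ Fle] := HF' k.
  apply: (le_trans _ (le_trans Fle _)); last by rewrite leeD2l// lee_fin ltW.
  apply: le_measure; rewrite ?inE//; last exact: bigcap_inf.
  by apply: bigcapT_measurable => i; case: (HF' i).
rewrite -(@measurable_mu_extE _ _ _ mu (\bigcap_k F k)); last first.
  by apply: bigcapT_measurable => i; case: (HF' i).
apply: le_mu_ext => x Ax k _.
by case: (HF' k) => _ + _; exact.
Qed.

(** Take complements of the hulls of [F k `\` A], where the sets [F k] have finite
    measure and increase to the whole space. *)
Lemma measurable_kernel (A : set T) : mue.-cara.-measurable A ->
  exists B, [/\ measurable B, B `<=` A & mu B = mue A].
Proof.
move=> mA.
have [F [FT Fnd Ffin]] := (sigma_finiteP _ _).1 sfin.
have HB k : exists B : set T, [/\ measurable B, B `<=` A & cmu (A `&` F k) <= mu B].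
  have [mF Fy] := Ffin k.
  have [H [mH FAH HE]] := measurable_hull (F k `\` A).
  exists (F k `\` H); split.
  - exact: measurableD.
  - by move=> x [Fx nH]; apply: contrapT => nA; apply: nH; exact: FAH.
  - have mFc : mue.-cara.-measurable (F k) by exact: caratheodory_measurable_mu_ext.
    have Ff : mu (F k) \is a fin_num by rewrite ge0_fin_numE.
    have E1 : mu (F k) = cmu (A `&` F k) + mue (F k `\` A).
      by rewrite -(measurable_mu_extE mu mF) (mA (F k)) setIC.
    have mDf : mue (F k `\` A) \is a fin_num.
      rewrite ge0_fin_numE ?mu_ext_ge0//.
      apply: (@le_lt_trans _ _ (mu (F k))) => //.
      by rewrite -[leRHS](measurable_mu_extE mu mF) le_mu_ext.
    have -> : cmu (A `&` F k) = mu (F k) - mue (F k `\` A) by rewrite E1 addeK.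
    rewrite leeBlDr//; rewrite -HE -measureU//; [|exact: measurableD|].
      apply: le_measure; rewrite ?inE//; first by apply: measurableU => //; exact: measurableD.
      by move=> x Fx; have [Hx|nHx] := pselect (H x); [right|left].
    by apply/seteqP; split => // x [[_ nH] /nH].
have [B HB'] := choice HB.
have mB : measurable (\bigcup_k B k).
  by apply: bigcupT_measurable => k; case: (HB' k).
have BA : \bigcup_k B k `<=` A.
  by move=> x [k _]; case: (HB' k) => _ + _; exact.
exists (\bigcup_k B k); split => //.
apply/eqP; rewrite eq_le; apply/andP; split.
  by rewrite -(measurable_mu_extE mu mB) le_mu_ext.
have mFc k : mue.-cara.-measurable (F k).
  by apply: caratheodory_measurable_mu_ext; case: (Ffin k).
have AE : A = \bigcup_k (A `&` F k) by rewrite -setI_bigcupr -FT setIT.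
have cv : (cmu \o (fun k => A `&` F k)) x @[x --> \oo] --> cmu A.
  rewrite [in X in _ --> X]AE; apply: nondecreasing_cvg_mu.
  - by move=> k; apply: measurableI.
  - by rewrite -AE.
  - by move=> n m /Fnd/subsetPset nm; apply/subsetPset; apply: setIS.
have := cvg_lim (@ereal_hausdorff R) cv; rewrite -[mue A]/(cmu A) => <-.
apply: lime_le; first by apply/cvg_ex; exists (cmu A).
near=> k; have [mBk _ /le_trans] := HB' k; apply.
by apply: le_measure; rewrite ?inE//; exact: bigcup_sup.
Unshelve. all: by end_near. Qed.

Import HBNNSimple.

(** A simple function for [mu] is also one for its completion. *)
Lemma integral_completed_ge (phi g : T -> \bar R) : measurable_fun setT phi ->
  (forall x, 0 <= phi x) -> (forall x, phi x <= g x) ->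
  \int[mu]_x phi x <= \int[cmu]_x g x.
Proof.
move=> mphi phi0 phig.
have g0 x : 0 <= g x by exact: le_trans (phi0 x) (phig x).
rewrite (ge0_integralTE mu)// (ge0_integralTE cmu)//.
apply: ge_ereal_sup => _ [h hphi <-].
have mh : measurable_fun (setT : set (caratheodory_type mue)) (h : _ -> R).
  move=> _ Y mY; apply: caratheodory_measurable_mu_ext.
  exact: (@measurable_funPT _ _ _ _ h).
pose hM := isMeasurableFun.Build _ _ (caratheodory_type mue) R h mh.
pose hF := FiniteImage.Build (caratheodory_type mue) R h (@fimfunP _ _ h).
pose hN := isNonNegFun.Build (caratheodory_type mue) R h (fun x => @fun_ge0 _ _ h x).
pose h' : {nnsfun caratheodory_type mue >-> R} := 
  HB.pack (h : caratheodory_type mue -> R) hM hF hN.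
apply: ereal_sup_ubound; exists h'; first by move=> x; exact: le_trans (hphi x) (phig x).
rewrite /sintegral; apply: eq_fsbigr => r _; congr (_ * _).
exact: measurable_mu_extE.
Qed.

(** In a simple function below [g], each level set is replaced by a measurable
    subset of the same measure. *)
Lemma integral_completed_approx (g : T -> \bar R) r :
  (forall x, 0 <= g x) -> r < \int[cmu]_x g x ->
  exists phi : T -> \bar R, [/\ measurable_fun setT phi,
    forall x, 0 <= phi x <= g x & r < \int[mu]_x phi x].
Proof.
move=> g0; rewrite (ge0_integralTE cmu)// => /ereal_sup_gt[_ [h hg <-] rh].
have mh y : mue.-cara.-measurable (h @^-1` [set y]).
  by have := @measurable_funPT _ _ _ _ h measurableT _ (measurable_set1 y); rewrite setTI.
have [B HB] := choice (fun y => measurable_kernel (mh y)).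
(* [Num.max 0 y] is [y] on the range of [h]; it makes every term of the family
   nonnegative, including those outside the range. *)
pose F (y : R) x : \bar R := (Num.max 0 y * \1_(B y) x)%:E.
have mF y : measurable_fun setT (F y).
  apply/measurable_EFinP/measurable_funM => //.
  by apply: measurable_indic; case: (HB y).
have F0 y x : 0 <= F y x by rewrite lee_fin mulr_ge0 ?le_max ?lexx// indicE ler0n.
have fr : finite_set (range h) by exact: fimfunP.
exists (fun x => \sum_(y \in range h) F y x); split.
- under eq_fun do rewrite fsbig_finite//=.
  exact: emeasurable_sum.
- move=> x.
  have -> : \sum_(y \in range h) F y x = F (h x) x.
    rewrite (fsbigD1 (h x))//=; last by exists x.
    rewrite fsbig1 ?adde0// => y [_ yh].
    rewrite /F indicE memNset ?mulr0// => Byx; apply: yh.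
    by have [_ /(_ _ Byx)] := HB y.
  rewrite F0; apply: le_trans (hg x); rewrite lee_fin.
  by rewrite (max_idPr _) ?fun_ge0// ler_piMr// fun_ge0.
- rewrite ge0_integral_fsum//.
  suff -> : \sum_(y \in range h) \int[mu]_x F y x = sintegral cmu h by [].
  rewrite sintegralE; apply: eq_fsbigr => y /[1!inE] -[x _ yx].
  have y0 : (0 <= y)%R by rewrite -yx fun_ge0.
  have [mBy _ By] := HB y.
  rewrite /F (max_idPr y0).
  under eq_integral do rewrite EFinM.
  rewrite ge0_integralZl//=; last exact/measurable_EFinP/measurable_indic.
  by rewrite integral_indic// setIT By.
Qed.

End lower_integral.

(** * Lebesgue measure on the line and on tuples *)

Section affine.
Variable R : realType.
Local Notation mR := (measurableTypeR R).
Local Notation leb := (@lebesgue_measure R).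

Lemma measurable_affine (c b : R) :
  measurable_fun setT (fun s : mR => (c * s + b)%R : mR).
Proof.
by apply: measurable_funD => //; apply: measurable_funM.
Qed.

(** By uniqueness: the rescaled pushforward has the right value on intervals. *)
Lemma lebesgue_measure_affine (c b : R) (A : set mR) : (0 < c)%R ->
  measurable A ->
  leb ((fun s : mR => c * s + b)%R @^-1` A) = (c^-1)%:E * leb A.
Proof.
move=> c0 mA.
pose push : {measure set mR -> \bar R} :=
  measure_function_pushforward__canonical__measure_function_Measure
    leb (measurable_affine c b).
pose mu := mscale (NngNum (ltW c0)) push.
have muE X : ocitv X -> leb X = mu X.
  move=> -[[x y]] /= xy <-.
  rewrite /mu /mscale /=.
  have -> : push `]x, y]%classic = leb `]((x - b) / c)%R, ((y - b) / c)%R]%classic.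
    rewrite /push/= /pushforward; congr (leb _); apply/seteqP; split=> s /=;
      rewrite !in_itv/= ltr_pdivrMr// ler_pdivlMr// ltrBlDr lerBrDr mulrC//.
  rewrite !lebesgue_measure_itv/= !lte_fin ltr_pM2r ?invr_gt0// ltrD2r.
  case: ltP => _; last by rewrite mule0.
  by rewrite -!EFinB -EFinM; congr EFin; field; rewrite gt_eqF.
rewrite [X in _ = _ * X](lebesgue_measure_unique muE mA) /mu /mscale/= muleA -EFinM mulVf ?gt_eqF//.
by rewrite mul1e.
Qed.

Lemma ge0_integral_affine (c b : R) (f : mR -> \bar R) : (0 < c)%R ->
  measurable_fun setT f -> (forall x, 0 <= f x) ->
  \int[leb]_s f (c * s + b)%R = (c^-1)%:E * \int[leb]_s f s.
Proof.
move=> c0 mf f0.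
have := @ge0_integral_pushforward _ _ _ _ R _ (measurable_affine c b) leb setT f
  measurableT mf (fun x _ => f0 x).
rewrite preimage_setT => <-.
have ci0 : (0 <= c^-1)%R by rewrite invr_ge0 ltW.
have := @ge0_integral_mscale _ _ R leb setT measurableT (NngNum ci0) f mf (fun x _ => f0 x).
move=> /= <-.
apply: eq_measure_integral; first exact: measurable_affine.
by move=> ? A mA _; rewrite /= /mscale/=; exact: lebesgue_measure_affine.
Qed.
End affine.

Section rectangles.
Variable R : realType.
Local Notation mR := (measurableTypeR R).
Local Notation leb := (@lebesgue_measure R).
Local Notation T n := (n.-tuple mR).

Definition rect n (A : 'I_n -> set mR) : set (T n) :=
  [set t | forall i, A i (tnth t i)].

Lemma measurable_rect n (A : 'I_n -> set mR) : (forall i, measurable (A i)) ->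
  measurable (rect A).
Proof.
move=> mA.
have -> : rect A = \bigcap_(i in [set: 'I_n]) ((fun t => @tnth _ _ t i) @^-1` (A i)).
  by apply/seteqP; split => t h i; [move=> _; exact: h | exact: (h i)].
apply: fin_bigcap_measurable => // i _; rewrite -[X in measurable X]setTI.
exact: measurable_tnth.
Qed.

Lemma tnth_tcons0 n (p : T n * mR) : tnth (tcons p) ord0 = p.2.
Proof. by rewrite (tnth_nth p.2). Qed.

Lemma tnth_tconsS n (p : T n * mR) i : tnth (tcons p) (lift ord0 i) = tnth p.1 i.
Proof. by rewrite !(tnth_nth p.2)/=. Qed.

Lemma borel_rect n (A : 'I_n -> set mR) : (forall i, measurable (A i)) ->
  borel_lebesgue_Rn R n (rect A) = \prod_(i < n) leb (A i).
Proof.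
elim: n A => [|n IH] A mA.
  rewrite big_ord0 /= diracE mem_set// => -[]//.
rewrite big_ord_recl /= /product_step /pushforward.
have -> : @tcons R n @^-1` rect A =
    rect (fun i => A (lift ord0 i)) `*` A ord0.
  apply/seteqP; split=> -[t s] /=.
    by move=> h; split=> [i|]; [have := h (lift ord0 i); rewrite tnth_tconsS
                               |have := h ord0; rewrite tnth_tcons0].
  move=> [h1 h2] i; case: (unliftP ord0 i) => [j|] ->; rewrite ?tnth_tconsS ?tnth_tcons0//.
rewrite product_measure1E//; last by apply: measurable_rect.
by rewrite muleC; congr (_ * _); exact: IH.
Qed.

Lemma borel_lebesgue_sigma_finite n : sigma_finite setT (borel_lebesgue_Rn R n).
Proof.
exists (fun k => rect (fun _ : 'I_n => `[(- k%:R)%R, k%:R%R]%classic : set mR)).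
  apply/seteqP; split => // t _.
  have [k kP] : exists k : nat, forall i, (`|tnth t i| <= k%:R)%R.
    exists (Num.truncn (\sum_i `|tnth t i|)%R).+1 => i.
    apply: le_trans (ltW (truncnS_gt _)).
    by rewrite (bigD1 i)//= lerDl sumr_ge0.
  by exists k => // i /=; rewrite in_itv/= -ler_norml.
move=> k; split; first by apply: measurable_rect => i; exact: measurable_itv.
rewrite borel_rect; last by move=> i; exact: measurable_itv.
rewrite (eq_bigr (fun=> ((2 * k%:R)%R)%:E)); last first.
  move=> i _; rewrite lebesgue_measure_itv/= lte_fin.
  case: ltP => [_|]; first by rewrite -EFinB; congr EFin; ring.
  move=> k0; congr EFin; have : (0 <= k%:R :> R)%R by [].
  by lra.
by rewrite prodEFin ltry.
Qed.

End rectangles.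

(** A copy of the Borel measure underlying [lebesgue_Rn], to carry its sigma-finite
    structure, which the theorems of Tonelli and Fubini require. *)
Definition borel_leb (R : realType) n : set (n.-tuple (measurableTypeR R)) -> \bar R :=
  borel_lebesgue_Rn R n.
Arguments borel_leb : clear implicits.
HB.instance Definition _ (R : realType) n := Measure.copy (borel_leb R n) (borel_lebesgue_Rn R n).
HB.instance Definition _ (R : realType) n := Measure_isSigmaFinite.Build _ _ _ (borel_leb R n)
  (@borel_lebesgue_sigma_finite R n).

Section borel_leb_integral.
Variable R : realType.
Local Notation mR := (measurableTypeR R).
Local Notation leb := (@lebesgue_measure R).
Local Notation T n := (n.-tuple mR).

Lemma integral_tuple0 (f : T 0 -> \bar R) : measurable_fun setT f ->
  \int[borel_leb R 0]_x f x = f [tuple].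
Proof.
move=> mf; have := @integral_dirac _ (T 0) [tuple] R setT measurableT f mf.
by rewrite diracT mul1e.
Qed.

Lemma measurable_fun_tcons n (f : T n.+1 -> \bar R) : measurable_fun setT f ->
  measurable_fun setT (f \o @tcons R n).
Proof. by move=> mf; apply: measurableT_comp => //; exact: measurable_tcons. Qed.

Lemma measurable_tcons_section n (f : T n.+1 -> \bar R) x : measurable_fun setT f ->
  measurable_fun setT (fun s : mR => f (tcons (x, s))).
Proof. by move=> /measurable_fun_tcons/(measurable_fun_pair2 x). Qed.

Lemma measurable_integral_tcons n (f : T n.+1 -> \bar R) : measurable_fun setT f ->
  (forall t, 0 <= f t) -> measurable_fun setT (fun x => \int[leb]_s f (tcons (x, s))).
Proof.
move=> mf f0.
exact: (@measurable_fun_fubini_tonelli_F _ _ _ _ _ leb _ (measurable_fun_tcons mf) (fun x => f0 _)).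
Qed.

Lemma ge0_integral_tcons n (f : T n.+1 -> \bar R) : measurable_fun setT f ->
  (forall t, 0 <= f t) ->
  \int[borel_leb R n.+1]_t f t = \int[borel_leb R n]_x \int[leb]_s f (tcons (x, s)).
Proof.
move=> mf f0.
have := @ge0_integral_pushforward _ _ _ _ R _ (@measurable_tcons R n)
  (borel_leb R n \x leb)%E setT f measurableT mf (fun x _ => f0 x).
rewrite preimage_setT => E.
transitivity (\int[borel_leb R n \x leb]_z (f \o @tcons R n) z); first exact: E.
by rewrite (fubini_tonelli1 _ (measurable_fun_tcons mf)) // => ? /=.
Qed.

(** The map [t |-> c t + a]. *)
Definition taffine n (c : R) (a t : T n) : T n :=
  [tuple (c * tnth t i + tnth a i)%R | i < n].

Lemma measurable_taffine n c (a : T n) : measurable_fun setT (taffine c a).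
Proof.
apply/measurable_fun_tnthP => i.
apply: (eq_measurable_fun (fun t => (c * tnth t i + tnth a i)%R)) => [t _|].
  by rewrite /= tnth_mktuple.
apply: (measurableT_comp (measurable_affine c (tnth a i))).
exact: measurable_tnth.
Qed.

Lemma taffine_tcons n c (a : T n) b x s :
  taffine c (tcons (a, b)) (tcons (x, s)) = tcons (taffine c a x, (c * s + b)%R).
Proof.
apply/eq_from_tnth => i; rewrite tnth_mktuple.
by case: (unliftP ord0 i) => [j|] ->; rewrite ?tnth_tconsS ?tnth_tcons0//= tnth_mktuple.
Qed.

Lemma tcons_surj n (t : T n.+1) : exists x s, t = tcons (x, s).
Proof.
exists [tuple of behead t], (thead t).
by rewrite [LHS]tuple_eta; apply/val_inj.
Qed.

Lemma ge0_integral_taffine n (c : R) (a : T n) (f : T n -> \bar R) : (0 < c)%R ->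
  measurable_fun setT f -> (forall x, 0 <= f x) ->
  \int[borel_leb R n]_t f (taffine c a t) = (c^-1 ^+ n)%:E * \int[borel_leb R n]_t f t.
Proof.
move=> c0; elim: n a f => [|n IH] a f mf f0.
  rewrite expr0 mul1e; apply: eq_integral => t _; congr f.
  by apply/eq_from_tnth => -[].
have [x [s ->]] := tcons_surj a.
rewrite !ge0_integral_tcons//; last first.
  by apply: measurableT_comp => //; exact: measurable_taffine.
under eq_integral => y _.
  under eq_integral do rewrite taffine_tcons.
  rewrite (ge0_integral_affine s (f := fun s => f (tcons (taffine c x y, s)))) //; last first.
    exact: measurable_tcons_section.
  over.
have mF := measurable_integral_tcons mf f0.
rewrite ge0_integralZl//=; last 3 first.
- apply: (measurableT_comp (f := fun x => \int[leb]_s f (tcons (x, s)))) => //.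
  exact: measurable_taffine.
- by move=> y _; exact: integral_ge0.
- by rewrite lee_fin invr_ge0 ltW.
rewrite (IH _ (fun y => \int[leb]_s f (tcons (y, s))))//; last first.
  by move=> y; exact: integral_ge0.
by rewrite muleA -EFinM -exprS.
Qed.

End borel_leb_integral.

(** * The Brunn-Minkowski inequality on the line *)

Lemma lt_dense_real (R : realType) (a : R) (x : \bar R) : a%:E < x ->
  exists2 s, (a < s)%R & s%:E < x.
Proof.
case: x => [x| |] //= ax; last by exists (a + 1)%R; rewrite ?ltrDl ?ltry.
exists ((a + x) / 2)%R; first by rewrite midf_lt.
by rewrite lte_fin midf_lt.
Qed.

Section brunn_minkowski.
Variable R : realType.
Local Notation mR := (measurableTypeR R).
Local Notation leb := (@lebesgue_measure R).

(** A point of [A] close enough to [sup A] leaves only a small part of [A] above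
    it; [A] may lose its maximum, which has measure zero. *)
Lemma lebesgue_below_sup (A : set mR) (r : \bar R) : measurable A -> r < leb A ->
  A !=set0 -> exists2 a, A a & r < leb (A `&` `]-oo, a[).
Proof.
move=> mA rA A0.
(* a sequence increasing to the supremum of [A] in [-oo, +oo] *)
pose c (k : nat) : R := if pselect (has_ubound A) then (sup A - k.+1%:R^-1)%R else k%:R.
have cA k : exists2 a, A a & (c k < a)%R.
  rewrite /c; case: pselect => [ubA|nub] /=.
    by have [] := @sup_adherent _ A k.+1%:R^-1 _ _ => // a Aa ?; exists a.
  apply: contrapT => H; apply: nub; exists k%:R => a Aa.
  by rewrite leNgt; apply/negP => ka; apply: H; exists a.
have cnd : {homo c : i j / (i <= j)%N >-> (i <= j)%R}.
  move=> i j ij; rewrite /c; case: pselect => _ /=; last by rewrite ler_nat.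
  by rewrite lerD2l lerN2 lef_pV2 ?posrE// ler_nat.
pose X k : set mR := A `&` `]-oo, c k].
have mX k : measurable (X k) by apply: measurableI => //; exact: measurable_itv.
have sub : A `\ sup A `<=` \bigcup_k X k.
  move=> x [Ax /eqP xS]; have [k xk] : exists k, (x <= c k)%R.
    rewrite /c; case: pselect => [ubA|_] /=; last first.
      by exists (Num.truncn x).+1; apply/ltW/truncnS_gt.
    have xlt : (0 < sup A - x)%R.
      by rewrite subr_gt0 lt_neqAle xS/= ub_le_sup.
    have [k _ +] := near_infty_natSinv_lt (PosNum xlt).
    by move=> /(_ k (leqnn k))/= /ltW; exists k; rewrite lerBrDl -lerBrDr.
  by exists k => //; split => //=; rewrite in_itv.
have mU : measurable (\bigcup_k X k) by exact: bigcupT_measurable.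
have lU : r < leb (\bigcup_k X k).
  apply: lt_le_trans rA _.
  have -> : leb A = leb (A `\ sup A).
    rewrite (@measureDI _ _ _ leb A [set sup A])//.
    rewrite [X in _ + X](_ : _ = 0) ?adde0//.
    apply/eqP; rewrite eq_le measure_ge0 andbT -(lebesgue_measure_set1 (sup A)).
    by apply: le_measure; rewrite ?inE//; exact: measurableI.
  by apply: le_measure; rewrite ?inE//; exact: measurableD.
have cv : (leb \o X) k @[k --> \oo] --> leb (\bigcup_k X k).
  apply: nondecreasing_cvg_mu => // i j ij; apply/subsetPset; apply: setIS => x /=.
  by rewrite !in_itv/= => /le_trans; apply; exact: cnd.
have [k rk] : exists k, r < leb (X k).
  apply: contrapT => H; move: lU; apply/negP; rewrite -leNgt.
  rewrite -(cvg_lim (@ereal_hausdorff R) cv); apply: lime_le.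
    by apply/cvg_ex; exists (leb (\bigcup_k X k)).
  by apply: nearW => k; rewrite leNgt; apply/negP => rk; apply: H; exists k.
have [a Aa ka] := cA k.
exists a => //; apply: lt_le_trans rk _; apply: le_measure; rewrite ?inE//.
  by apply: measurableI => //; exact: measurable_itv.
by apply: setIS => x /=; rewrite !in_itv/= => /le_lt_trans; apply.
Qed.

Lemma lebesgue_above_inf (B : set mR) (r : \bar R) : measurable B -> r < leb B ->
  B !=set0 -> exists2 b, B b & r < leb (B `&` `[b, +oo[).
Proof.
move=> mB; have mN : measurable ((-%R : R -> mR) @^-1` B).
  by rewrite -[X in measurable X]setTI; exact: oppr_measurable.
rewrite -(lebesgue_measureN mB) => rB [b Bb].
have [|a Ba ra] := lebesgue_below_sup mN rB; first by exists (- b)%R; rewrite /= opprK.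
exists (- a)%R => //; apply: lt_le_trans ra _.
have mI : measurable (B `&` `[(- a)%R, +oo[ : set mR).
  by apply: measurableI => //; exact: measurable_itv.
rewrite -(lebesgue_measureN mI) /pushforward.
apply: le_measure; rewrite ?inE.
- by apply: measurableI => //; exact: measurable_itv.
- by rewrite -[X in measurable X]setTI; exact: oppr_measurable.
- by move=> x [Bx] /=; rewrite !in_itv/= andbT lerN2 => /ltW.
Qed.

(** Choose [a] in [A] near its supremum and [b] in [B] near its infimum.  The
    translates [(A below a) + b] and [a + (B from b on)] lie on either side of
    [a + b], hence are disjoint, and both lie in [C]. *)
Lemma brunn_minkowski_sum_1d (A B C : set mR) :
  measurable A -> measurable B -> measurable C -> A !=set0 -> B !=set0 ->
  (forall x y, A x -> B y -> C (x + y)%R) -> leb A + leb B <= leb C.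
Proof.
move=> mA mB mC A0 B0 ABC.
have half r s : r%:E < leb A -> s%:E < leb B -> (r + s)%:E <= leb C.
  move=> /lebesgue_below_sup [//|//|a Aa ra] /lebesgue_above_inf [//|//|b Bb sb].
  have mAa : measurable (A `&` `]-oo, a[ : set mR).
    by apply: measurableI => //; exact: measurable_itv.
  have mBb : measurable (B `&` `[b, +oo[ : set mR).
    by apply: measurableI => //; exact: measurable_itv.
  have tr (X : set mR) e : measurable X -> leb X = leb ((fun s : mR => 1 * s + e)%R @^-1` X).
    by move=> mX; rewrite lebesgue_measure_affine// invr1 mul1e.
  have mtr (X : set mR) e : measurable X -> measurable ((fun s : mR => 1 * s + e)%R @^-1` X).
    by move=> mX; rewrite -[Y in measurable Y]setTI; exact: measurable_affine.
  apply: (@le_trans _ _ (leb (A `&` `]-oo, a[) + leb (B `&` `[b, +oo[))).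
    by rewrite EFinD leeD// ltW.
  rewrite (tr _ (- b)%R)// [X in _ + X](tr _ (- a)%R)//.
  rewrite -measureU//; try exact: mtr; last first.
    apply/seteqP; split => // x [] [_ /=]; rewrite in_itv/= => h1 [_ /=].
    by rewrite in_itv/= andbT; lra.
  apply: le_measure; rewrite ?inE//; first by apply: measurableU; exact: mtr.
  move=> x [] /= [].
    by move=> Ax _; rewrite (_ : x = (1 * x - b + b)%R); [exact: ABC|ring].
  by move=> Bx _; rewrite (_ : x = (a + (1 * x - a))%R); [exact: ABC|ring].
have infty r : r%:E < leb A + leb B -> (leb A == +oo) || (leb B == +oo) -> r%:E <= leb C.
  move=> _ /orP[|] /eqP E.
    have B1 : (-1)%:E < leb B by apply: lt_le_trans (measure_ge0 _ _); rewrite lte_fin ltrN10.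
    by have := half (r + 1)%R (-1)%R; rewrite addrK; apply => //; rewrite E ltry.
  have A1 : (-1)%:E < leb A by apply: lt_le_trans (measure_ge0 _ _); rewrite lte_fin ltrN10.
  by have := half (-1)%R (r + 1)%R; rewrite (addrC r) addKr; apply => //; rewrite E ltry.
have [|] := boolP ((leb A == +oo) || (leb B == +oo)).
  move=> H; have -> : leb C = +oo; last by rewrite leey.
  apply/eqyP => r _; apply: infty => //.
  case/orP: H => /eqP ->; first by rewrite addye ?ltry// -ltNye (lt_le_trans _ (measure_ge0 _ _)).
  by rewrite addey ?ltry// -ltNye (lt_le_trans _ (measure_ge0 _ _)).
rewrite negb_or => /andP[Afin Bfin].
have mfin (X : set mR) : leb X != +oo -> leb X \is a fin_num.
  by move=> h; rewrite ge0_fin_numE// lt_neqAle h leey.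
move: (mfin _ Afin) (mfin _ Bfin) half => /fineK <- /fineK <- half.
rewrite -EFinD; apply/lee_addgt0Pr => e e0.
rewrite -leeBlDr// -EFinB.
have := half (fine (leb A) - e / 2)%R (fine (leb B) - e / 2)%R.
rewrite !lte_fin !ltrBlDr !ltrDl !divr_gt0// => /(_ isT isT).
by apply: le_trans; rewrite lee_fin; lra.
Qed.

Lemma brunn_minkowski_1d (l : R) (A B C : set mR) : (0 < l < 1)%R ->
  measurable A -> measurable B -> measurable C -> A !=set0 -> B !=set0 ->
  (forall x y, A x -> B y -> C ((1 - l) * x + l * y)%R) ->
  (1 - l)%:E * leb A + l%:E * leb B <= leb C.
Proof.
move=> /andP[l0 l1] mA mB mC [a Aa] [b Bb] ABC.
have l1' : (0 < 1 - l)%R by rewrite subr_gt0.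
have scale (c : R) (X : set mR) : (0 < c)%R -> measurable X ->
    c%:E * leb X = leb ((fun s : mR => c^-1 * s + 0)%R @^-1` X).
  by move=> c0 mX; rewrite lebesgue_measure_affine ?invr_gt0// invrK.
have mscale' (c : R) (X : set mR) : measurable X ->
    measurable ((fun s : mR => c^-1 * s + 0)%R @^-1` X).
  by move=> mX; rewrite -[Y in measurable Y]setTI; exact: measurable_affine.
rewrite !scale//; apply: brunn_minkowski_sum_1d => //; try exact: mscale'.
- by exists ((1 - l) * a)%R; rewrite /= addr0 mulKf// gt_eqF.
- by exists (l * b)%R; rewrite /= addr0 mulKf// gt_eqF.
- move=> x y /=; rewrite !addr0 => Ax By.
  by have := ABC _ _ Ax By; rewrite !mulVKf// gt_eqF.
Qed.

End brunn_minkowski.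

(** * The Prekopa-Leindler inequality *)

Section layer_cake.
Context d (T : measurableType d) (R : realType).
Variable mu : {sigma_finite_measure set T -> \bar R}.
Local Notation mR := (measurableTypeR R).
Local Notation leb := (@lebesgue_measure R).
Variable f : T -> \bar R.
Hypothesis mf : measurable_fun setT f.
Hypothesis f01 : forall x, 0 <= f x <= 1.

Let level r : set T := [set x | (0 < r < 1)%R /\ r%:E < f x].
Let E : set (T * mR) := [set z | (0 < z.2 < 1)%R /\ (z.2)%:E < f z.1].

Let mE : measurable E.
Proof.
have -> : E = (setT `*` (`]0%R, 1%R[ : set mR)) `&` [set z | (z.2)%:E < f z.1].
  by apply/seteqP; split=> -[x r] /=; rewrite in_itv/=; [move=> [? ?]|move=> [[_ ?] ?]].
apply: measurableI; first by apply: measurableX => //; exact: measurable_itv.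
rewrite -[X in measurable X]setTI; apply: measurable_lte => //.
  by apply/measurable_EFinP; exact: measurable_snd.
by apply: measurableT_comp => //; exact: measurable_fst.
Qed.

Let levelE r : level r = ysection E r.
Proof. by apply/seteqP; split=> x; rewrite /ysection/= inE. Qed.

Lemma measurable_level r : measurable (level r).
Proof. by rewrite levelE; exact: measurable_ysection. Qed.

Lemma measurable_mu_level : measurable_fun setT (fun r : mR => mu (level r)).
Proof.
under eq_fun do rewrite levelE.
exact: (measurable_fun_ysection mu mE).
Qed.

(** Tonelli's theorem for the region under the graph of [f]. *)
Lemma layer_cake : \int[mu]_x f x = \int[leb]_r mu (level r).
Proof.
have xE x : leb (xsection E x) = f x.
  have /andP[fx0 fx1] := f01 x.
  have ff : f x \is a fin_num by rewrite ge0_fin_numE// (le_lt_trans fx1) ?ltry.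
  move: fx0 fx1; rewrite -(fineK ff) !lee_fin => fx0 fx1.
  have -> : xsection E x = `]0%R, (fine (f x))[%classic.
    apply/seteqP; split=> r;  rewrite /xsection/= inE /E/= in_itv/=.
      by rewrite -[in X in X -> _](fineK ff) lte_fin => -[/andP[-> _] ->].
    move=> /andP[r0 rf]; rewrite r0 (lt_le_trans rf)//.
    by rewrite -(fineK ff) lte_fin.
  rewrite lebesgue_measure_itv/= lte_fin; case: ltP => f0; first by rewrite sube0.
  by congr EFin; apply/eqP; rewrite eq_le fx0 f0.
have := @indic_fubini_tonelli _ _ _ _ R mu leb E mE.
rewrite (eq_integral f); last by move=> x _; rewrite indic_fubini_tonelli_FE//= xE.
move=> ->; apply: eq_integral => r _.
by rewrite indic_fubini_tonelli_GE//= levelE.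
Qed.
End layer_cake.

(** The hypothesis of Prekopa-Leindler for the weights [1 - l] and [l], in logarithmic
    threshold form. *)
Definition log_comb (R : realType) U (comb : U -> U -> U) (l : R) (f g h : U -> \bar R) :=
  forall x y a b, (expR a)%:E < f x -> (expR b)%:E < g y ->
  (expR ((1 - l) * a + l * b))%:E <= h (comb x y).

Lemma expR_amgm (R : realType) (l a b : R) : (0 < l < 1)%R ->
  (expR ((1 - l) * a + l * b) <= (1 - l) * expR a + l * expR b)%R.
Proof.
move=> /andP[l0 l1].
have l01 : Itv.spec (@Itv.num_sem R) (Itv.Real `[0%Z, 1%Z]) l.
  by rewrite /Itv.num_sem/= in_itv/= ltW ?ltW// ger0_real ?ltW.
have := @convex_expR R (Itv.mk l01) b a.
rewrite !convRE/= /unstable.onem.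
by rewrite addrC [X in (_ <= X)%R]addrC.
Qed.

Section truncation.
Context d (T : measurableType d) (R : realType) (mu : {measure set T -> \bar R}).

(** [M] is a truncation level that [f] reaches or approaches: this is what makes
    all superlevel sets of the truncated function below [M] nonempty, as the
    Brunn-Minkowski inequality requires. *)
Lemma integral_truncation (f : T -> \bar R) (r : \bar R) : measurable_fun setT f ->
  (forall x, 0 <= f x) -> 0 <= r -> r < \int[mu]_x f x ->
  exists M, [/\ (0 < M)%R, r < \int[mu]_x mine (f x) M%:E &
    forall s, (s < M)%R -> exists x, s%:E < f x].
Proof.
move=> mf f0 r0 rf.
pose g (k : nat) x := mine (f x) k%:R%:E.
have mg k : measurable_fun setT (g k) by exact: measurable_mine.
have g0 k x : 0 <= g k x by rewrite /g le_min f0 lee_fin ler0n.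
have gnd x : {homo g^~ x : n m / (n <= m)%N >-> n <= m}.
  by move=> n m nm; rewrite /g le_min ge_min lexx/= ge_min lee_fin ler_nat nm orbT.
have gf x : g k x @[k --> \oo] --> f x.
  have := gnd x => /ereal_nondecreasing_cvgn.
  suff -> : ereal_sup (range (g^~ x)) = f x by [].
  apply/eqP; rewrite eq_le; apply/andP; split.
    by apply: ge_ereal_sup => _ [k _ <-]; rewrite /g ge_min lexx.
  have := f0 x; case E : (f x) => [y| |]// y0.
    apply: ereal_sup_ubound; exists (Num.truncn y).+1 => //.
    by rewrite /g E; apply/min_idPl; rewrite lee_fin ltW// truncnS_gt.
  rewrite leye_eq; apply/eqP/eqyP => z z0.
  apply: (@le_trans _ _ (g (Num.truncn z).+1 x)); last by apply: ereal_sup_ubound; exists (Num.truncn z).+1.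
  by rewrite /g E (min_idPr _) ?leey// lee_fin ltW// truncnS_gt.
have [k rk] : exists k, r < \int[mu]_x g k x.
  apply: contrapT => H; move: rf; apply/negP; rewrite -leNgt.
  have -> : \int[mu]_x f x = \int[mu]_x (fun x => limn (g^~ x)) x.
    by apply: eq_integral => x _; rewrite (cvg_lim _ (gf x)).
  have cv := @cvg_monotone_convergence _ _ _ mu setT measurableT _ mg (fun k x _ => g0 k x) (fun x _ => gnd x).
  rewrite -(cvg_lim (@ereal_hausdorff R) cv); apply: lime_le.
    by apply/cvg_ex; eexists; exact: cv.
  by apply: nearW => k; rewrite leNgt; apply/negP => rk; apply: H; exists k.
pose S := ereal_sup (range f).
have S0 : 0 <= S by apply: le_trans (f0 point) _; apply: ereal_sup_ubound; exists point.
(* truncating at [k] is truncating at [M'], which does not exceed the supremum *)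
pose M' := mine S k%:R%:E.
have gM x : g k x = mine (f x) M'.
  rewrite /g /M' minA; congr mine; apply/esym/min_idPl.
  by apply: ereal_sup_ubound; exists x.
have M'0 : 0 <= M' by rewrite le_min S0 lee_fin ler0n.
have M'f : M' \is a fin_num by rewrite ge0_fin_numE// gt_min ltry orbT.
exists (fine M'); rewrite fineK//; split.
- rewrite lt_neqAle fine_ge0// andbT; apply/eqP => M0.
  have ME : M' = 0 by rewrite -(fineK M'f) -M0.
  move: rk; apply/negP; rewrite -leNgt; apply: le_trans r0.
  rewrite integral0_eq// => x _; rewrite gM ME.
  by apply/min_idPr.
- by move: rk; under eq_integral do rewrite gM.
- move=> s sM; have : s%:E < S.
    apply: (@lt_le_trans _ _ M'); last by rewrite ge_min lexx.
    by rewrite -[ltRHS](fineK M'f) lte_fin.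
  by move=> /ereal_sup_gt [_ [x _ <-]]; exists x.
Qed.
End truncation.

Section prekopa_leindler.
Variable R : realType.
Local Notation mR := (measurableTypeR R).
Local Notation leb := (@lebesgue_measure R).
Local Notation T n := (n.-tuple mR).

Definition normalize d (U : measurableType d) (f : U -> \bar R) (M : R) x : \bar R :=
  (M^-1)%:E * mine (f x) M%:E.

Section normalize.
Context d (U : measurableType d) (mu : {measure set U -> \bar R}).
Variables (f : U -> \bar R) (M : R).
Hypotheses (M0 : (0 < M)%R) (mf : measurable_fun setT f) (f0 : forall x, 0 <= f x).

Lemma measurable_normalize : measurable_fun setT (normalize f M).
Proof. by apply: measurable_funeM; exact: measurable_mine. Qed.

Lemma normalize01 x : 0 <= normalize f M x <= 1.
Proof.
apply/andP; split.
  apply: mule_ge0; first by rewrite lee_fin invr_ge0 ltW.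
  by rewrite le_min f0 lee_fin ltW.
by rewrite /normalize lee_pdivrMl// mule1 ge_min lexx orbT.
Qed.

Lemma normalize_level r x : (r < 1)%R -> (r%:E < normalize f M x) = ((r * M)%:E < f x).
Proof.
move=> r1; rewrite /normalize lte_pdivlMl// -EFinM mulrC lt_min.
by rewrite lte_fin gtr_pMl// r1 andbT.
Qed.

Lemma integral_normalize : \int[mu]_x normalize f M x = (M^-1)%:E * \int[mu]_x mine (f x) M%:E.
Proof.
apply: ge0_integralZl => //.
- exact: measurable_mine.
- by move=> x _; rewrite le_min f0 lee_fin ltW.
- by rewrite lee_fin invr_ge0 ltW.
Qed.

Lemma integral_normalize_le : M%:E * \int[mu]_x normalize f M x <= \int[mu]_x f x.
Proof.
rewrite integral_normalize muleA -EFinM divff ?gt_eqF// mul1e.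
apply: ge0_le_integral => //.
- by move=> x _; rewrite le_min f0 lee_fin ltW.
- exact: measurable_mine.
- by move=> x _; rewrite ge_min lexx.
Qed.
End normalize.

(** After truncating [f] and [g] and normalizing them to have supremum 1 (and [h]
    accordingly), the superlevel sets at every height in ]0, 1[ are nonempty and satisfy the
    Brunn-Minkowski inequality.  Integrating over the height gives an inequality
    between arithmetic means, hence between geometric means. *)
Lemma prekopa_leindler_1d (l : R) (f g h : mR -> \bar R) : (0 < l < 1)%R ->
  measurable_fun setT f -> measurable_fun setT g -> measurable_fun setT h ->
  (forall x, 0 <= f x) -> (forall x, 0 <= g x) -> (forall x, 0 <= h x) ->
  log_comb (fun x y => (1 - l) * x + l * y)%R l f g h ->
  forall a b, (expR a)%:E < \int[leb]_x f x -> (expR b)%:E < \int[leb]_x g x ->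
    (expR ((1 - l) * a + l * b))%:E <= \int[leb]_x h x.
Proof.
move=> l01 mf mg mh f0 g0 h0 fgh a b af bg.
have /andP[l0 l1] := l01.
have l1' : (0 < 1 - l)%R by rewrite subr_gt0.
have ea0 c : (0 : \bar R) <= (expR c)%:E by rewrite lee_fin expR_ge0.
have [M [M0 aM fM]] := integral_truncation mf f0 (ea0 a) af.
have [N [N0 bN gN]] := integral_truncation mg g0 (ea0 b) bg.
pose K := expR ((1 - l) * ln M + l * ln N).
have K0 : (0 < K)%R by rewrite expR_gt0.
apply: le_trans (integral_normalize_le leb K0 mh h0).
have key : (1 - l)%:E * \int[leb]_x normalize f M x + l%:E * \int[leb]_x normalize g N x
    <= \int[leb]_x normalize h K x.
  have mfM := measurable_normalize M mf.
  have mgN := measurable_normalize N mg.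
  have mhK := measurable_normalize K mh.
  have f01 := normalize01 M0 f0.
  have g01 := normalize01 N0 g0.
  have h01 := normalize01 K0 h0.
  rewrite (layer_cake leb mfM f01) (layer_cake leb mgN g01) (layer_cake leb mhK h01).
  have mlf := measurable_mu_level leb mfM.
  have mlg := measurable_mu_level leb mgN.
  have mlh := measurable_mu_level leb mhK.
  rewrite -!ge0_integralZl//=; try by rewrite lee_fin ltW.
  rewrite -ge0_integralD//=; try (by move=> r _; rewrite mule_ge0// lee_fin ltW);
    try exact: measurable_funeM.
  apply: ge0_le_integral => //.
  - by move=> r _; rewrite adde_ge0// mule_ge0// lee_fin ltW.
  - by apply: emeasurable_funD; exact: measurable_funeM.
  move=> r _.
  have [r01|r01] := pselect (0 < r < 1)%R; last first.
    have E (u : mR -> \bar R) : [set x | (0 < r < 1)%R /\ r%:E < u x] = set0.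
      by rewrite predeqE => x; split=> [[]|[]].
    by rewrite !E !measure0 !mule0 adde0.
  have /andP[r0 r1] := r01.
  apply: brunn_minkowski_1d => //; try exact: measurable_level.
  - have [|x fx] := fM (r * M)%R; first by rewrite gtr_pMl.
    by exists x; split=> //; rewrite normalize_level.
  - have [|x gx] := gN (r * N)%R; first by rewrite gtr_pMl.
    by exists x; split=> //; rewrite normalize_level.
  - move=> x y [_ fx] [_ gy]; split=> //; move: fx gy.
    (* room for a strict inequality: the hypothesis on [h] only gives [<=] *)
    rewrite !normalize_level// => /lt_dense_real[s rs sf] /lt_dense_real[t rt tg].
    have rM0 : (0 < r * M)%R by rewrite mulr_gt0.
    have rN0 : (0 < r * N)%R by rewrite mulr_gt0.
    have s0 : (0 < s)%R by rewrite (lt_trans _ rs).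
    have t0 : (0 < t)%R by rewrite (lt_trans _ rt).
    have := fgh x y (ln s) (ln t); rewrite !lnK ?posrE// => /(_ sf tg).
    apply: lt_le_trans; rewrite lte_fin.
    rewrite -[X in (X * _ < _)%R](lnK (x := r)) ?posrE// -expRD ltr_expR.
    have : (ln (r * M) < ln s)%R by rewrite ltr_ln ?posrE.
    have : (ln (r * N) < ln t)%R by rewrite ltr_ln ?posrE.
    rewrite !lnM ?posrE// => ? ?.
    rewrite -subr_gt0.
    rewrite [ltRHS](_ : _ = (1 - l) * (ln s - (ln r + ln M)) + l * (ln t - (ln r + ln N)))%R; last by ring.
    by rewrite addr_gt0// mulr_gt0// subr_gt0.
apply: (@le_trans _ _ (K%:E * ((1 - l)%:E * (expR (a - ln M))%:E + l%:E * (expR (b - ln N))%:E))).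
  rewrite -!EFinM lee_fin.
  apply: (@le_trans _ _ (K * expR ((1 - l) * (a - ln M) + l * (b - ln N)))%R).
    by rewrite -expRD ler_expR le_eqVlt; apply/orP; left; apply/eqP; ring.
  by rewrite ler_pM2l// expR_amgm.
rewrite lee_pmul2l//; apply: le_trans key.
have norm_ge c (u : mR -> \bar R) L : (0 < L)%R -> measurable_fun setT u -> (forall x, 0 <= u x) ->
    (expR c)%:E < \int[leb]_x mine (u x) L%:E ->
    (expR (c - ln L))%:E <= \int[leb]_x normalize u L x.
  move=> L0 mu u0 cu; rewrite integral_normalize// lee_pdivlMl//.
  by rewrite -EFinM expRB lnK ?posrE// mulrC divfK ?gt_eqF// ltW.
by apply: leeD; rewrite lee_pmul2l ?lte_fin//; apply: norm_ge.
Qed.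

Definition tcomb n (l : R) (x y : T n) : T n :=
  [tuple ((1 - l) * tnth x i + l * tnth y i)%R | i < n].

Lemma tcomb_tcons n l (x y : T n) s t :
  tcomb l (tcons (x, s)) (tcons (y, t)) = tcons (tcomb l x y, ((1 - l) * s + l * t)%R).
Proof.
apply/eq_from_tnth => i; rewrite tnth_mktuple.
by case: (unliftP ord0 i) => [j|] ->; rewrite ?tnth_tconsS ?tnth_tcons0//= tnth_mktuple.
Qed.

(** Induction on the dimension: by the one-dimensional case, the integrals of [f],
    [g], [h] over the first coordinate satisfy the same hypothesis in the
    remaining variables. *)
Theorem prekopa_leindler n (l : R) (f g h : T n -> \bar R) : (0 < l < 1)%R ->
  measurable_fun setT f -> measurable_fun setT g -> measurable_fun setT h ->
  (forall x, 0 <= f x) -> (forall x, 0 <= g x) -> (forall x, 0 <= h x) ->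
  log_comb (tcomb l) l f g h ->
  forall a b, (expR a)%:E < \int[borel_leb R n]_x f x -> (expR b)%:E < \int[borel_leb R n]_x g x ->
    (expR ((1 - l) * a + l * b))%:E <= \int[borel_leb R n]_x h x.
Proof.
move=> l01; elim: n f g h => [|n IH] f g h mf mg mh f0 g0 h0 fgh a b.
  rewrite !integral_tuple0// => af bg; have := fgh _ _ _ _ af bg.
  by rewrite (tuple0 (tcomb _ _ _)).
rewrite !ge0_integral_tcons//; apply: IH.
1-3: exact: measurable_integral_tcons.
1-3: by move=> x; exact: integral_ge0.
move=> x y a' b'; apply: prekopa_leindler_1d => //.
1-3: exact: measurable_tcons_section.
by move=> s t c d cf dg; rewrite -tcomb_tcons; exact: fgh.
Qed.

End prekopa_leindler.

(** * The lower semicontinuous envelope *)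

Section lower_envelope.
Variables (R : realType) (n : nat).
Local Notation mR := (measurableTypeR R).
Local Notation leb := (@lebesgue_measure R).
Local Notation Tn := (n.-tuple mR).
Implicit Types (f : Tn -> \bar R) (c x y z : Tn).

Definition cube c (e : R) : set Tn :=
  rect (fun i => `](tnth c i - e)%R, (tnth c i + e)%R[%classic : set mR).

Lemma cubeP c e x : cube c e x <-> forall i, (`|tnth x i - tnth c i| < e)%R.
Proof.
split=> h i; have := h i; rewrite /= in_itv/= ltr_distlC.
  by move=> /andP[? ?]; apply/andP; split; lra.
by move=> /andP[? ?]; apply/andP; split; lra.
Qed.

Lemma cube_sub c d e e' : cube c e d -> cube d e' `<=` cube c (e + e').
Proof.
move=> /cubeP cd x /cubeP dx; apply/cubeP => i.
have -> : (tnth x i - tnth c i = (tnth d i - tnth c i) + (tnth x i - tnth d i))%R by ring.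
by apply: le_lt_trans (ler_normD _ _) _; rewrite ltrD.
Qed.

Lemma measurable_cube c e : measurable (cube c e).
Proof. by apply: measurable_rect => i; exact: measurable_itv. Qed.

Lemma borel_leb_cube c e : (0 < e)%R -> borel_leb R n (cube c e) = ((2 * e) ^+ n)%:E.
Proof.
move=> e0; rewrite /borel_leb borel_rect; last by move=> i; exact: measurable_itv.
rewrite (eq_bigr (fun=> (2 * e)%R%:E)); last first.
  move=> i _; rewrite lebesgue_measure_itv/= lte_fin ifT; last by lra.
  by rewrite -EFinB; congr EFin; ring.
by rewrite prodEFin prodr_const card_ord.
Qed.

Definition ratcube (q : n.-tuple rat * rat) : set Tn :=
  cube [tuple ratr (tnth q.1 i) | i < n] (ratr q.2).

Lemma ratcube_near z (e : R) : (0 < e)%R ->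
  exists2 q, ratcube q z & ratcube q `<=` cube z e.
Proof.
move=> e0.
have [r] := @rat_in_itvoo R 0%R (e / 2)%R ltac:(by rewrite divr_gt0).
rewrite in_itv/= => /andP[r0 re].
have H i : exists q : rat, (`|tnth z i - ratr q| < ratr r :> R)%R.
  have [q] := @rat_in_itvoo R (tnth z i - ratr r)%R (tnth z i)%R ltac:(lra).
  rewrite in_itv/= => /andP[q1 q2]; exists q.
  by rewrite ger0_norm ?subr_ge0 ?ltW//; lra.
have [q Hq] := choice H.
exists ([tuple q i | i < n], r).
  by apply/cubeP => i; rewrite !tnth_mktuple.
apply: (@subset_trans _ (cube z (ratr r + ratr r))).
  apply: cube_sub; apply/cubeP => i; rewrite !tnth_mktuple distrC; exact: Hq.
by move=> x /cubeP h; apply/cubeP => i; apply: lt_le_trans (h i) _; lra.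
Qed.

(** Countably many cubes suffice, which makes the envelope Borel whatever [f] is. *)
Definition lower_envelope f x : \bar R :=
  ereal_sup [set ereal_inf (f @` ratcube q) | q in [set q | ratcube q x]].

Lemma lower_envelope_le f x : lower_envelope f x <= f x.
Proof.
apply: ge_ereal_sup => _ [q qx <-]; apply: ereal_inf_lbound.
by exists x.
Qed.

Lemma lower_envelope_ge f (a : \bar R) z e : (0 < e)%R ->
  (forall x, cube z e x -> a <= f x) -> a <= lower_envelope f z.
Proof.
move=> e0 af; have [q qz qsub] := ratcube_near z e0.
apply: (@le_trans _ _ (ereal_inf (f @` ratcube q))).
  by apply: le_ereal_inf_tmp => _ [x qx <-]; apply: af; exact: qsub.
by apply: ereal_sup_ubound; exists q.
Qed.

Lemma measurable_lower_envelope f : measurable_fun setT (lower_envelope f).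
Proof.
move=> mD; apply: (measurability _ (ErealGenOInfty.measurableE R)) => //.
move=> _ [_ [r ->] <-]; rewrite setTI.
have -> : lower_envelope f @^-1` `]r%:E, +oo[ =
    \bigcup_(q in [set q | r%:E < ereal_inf (f @` ratcube q)]) ratcube q.
  apply/seteqP; split=> x /=.
    rewrite in_itv/= andbT => /ereal_sup_gt[_ [q qx <-] rq].
    by exists q.
  move=> [q /= rq qx]; rewrite in_itv/= andbT; apply: lt_le_trans rq _.
  by apply: ereal_sup_ubound; exists q.
rewrite bigcup_mkcond; apply: countable_bigcupT_measurable => [|q]; first exact: countableP.
by case: ifP => _ //; exact: measurable_cube.
Qed.

(** The envelope of [h] inherits the inequality because
    [(1 - l) x + l (cube c e)] is a cube centred at [(1 - l) x + l c]. *)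
Lemma lower_envelope_log_comb l f g h :
  log_comb (@tcomb R n l) l f g h -> (0 < l < 1)%R ->
  forall x c e, (0 < e)%R -> forall a b, (expR a)%:E < f x ->
    (forall y, cube c e y -> (expR b)%:E < g y) ->
  (expR ((1 - l) * a + l * b))%:E <= lower_envelope h (tcomb l x c).
Proof.
move=> fgh /andP[l0 l1] x c e e0 a b fx gc.
apply: (@lower_envelope_ge _ _ _ (l * e)%R); first by rewrite mulr_gt0.
move=> w /cubeP zw.
pose y : Tn := [tuple (tnth c i + l^-1 * (tnth w i - tnth (tcomb l x c) i))%R | i < n].
have -> : w = tcomb l x y.
  apply/eq_from_tnth => i; rewrite !tnth_mktuple mulrDr mulVKf ?gt_eqF//.
  ring.
apply: fgh => //; apply: gc; apply/cubeP => i.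
rewrite tnth_mktuple addrAC subrr add0r normrM gtr0_norm ?invr_gt0//.
by rewrite mulrC ltr_pdivrMr// mulrC.
Qed.

End lower_envelope.

Lemma le_of_expR_lt (R : realType) (x y : \bar R) :
  (forall a, (expR a)%:E < x -> (expR a)%:E <= y) -> 0 <= y -> x <= y.
Proof.
move=> h y0; rewrite leNgt; apply/negP => yx.
have yf : y \is a fin_num by rewrite ge0_fin_numE// (lt_le_trans yx) ?leey.
move: yx; rewrite -(fineK yf) => /lt_dense_real[s ys sx].
have s0 : (0 < s)%R by apply: le_lt_trans ys; rewrite fine_ge0.
have := h (ln s); rewrite lnK ?posrE// => /(_ sx).
by rewrite -(fineK yf) lee_fin leNgt ys.
Qed.

(** Let [l] tend to 0. *)
Lemma expR_le_of_log_comb (R : realType) (a b : R) (y : \bar R) :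
  (forall l, (0 < l < 1)%R -> (expR ((1 - l) * a + l * b))%:E <= y) -> (expR a)%:E <= y.
Proof.
move=> h; rewrite leNgt; apply/negP => ya.
have y0 : 0 < y.
  apply: lt_le_trans (h (2^-1)%R _); first by rewrite lte_fin expR_gt0.
  by rewrite invr_gt0 ltr0n/= invf_lt1// ltr1n.
have yf : y \is a fin_num by rewrite ge0_fin_numE ?(ltW y0)// (lt_le_trans ya) ?leey.
move: h ya y0; rewrite -(fineK yf) !lte_fin; set s := fine y => h sa s0.
rewrite -(lnK s0) ltr_expR in sa.
(* [l] is chosen so that [l * (a - b) < a - ln s] *)
pose M := (`|a - b| + (a - ln s) + 1)%R.
have M0 : (0 < M)%R by rewrite ltr_wpDl// addr_ge0// subr_ge0 ltW.
pose l := ((a - ln s) / (M + 1))%R.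
have M1 : (0 < M + 1)%R by rewrite addr_gt0.
have l0 : (0 < l)%R by rewrite divr_gt0// subr_gt0.
have l1 : (l < 1)%R.
  by rewrite ltr_pdivrMr// mul1r /M; have := normr_ge0 (a - b)%R; lra.
have := h l; rewrite l0 l1 => /(_ isT).
rewrite lee_fin -(lnK s0) ler_expR => H.
have : (a - ln s <= l * (a - b))%R by lra.
apply/negP; rewrite -ltNge.
apply: (@le_lt_trans _ _ (l * `|a - b|)%R); first by rewrite ler_pM2l// ler_norm.
rewrite /l mulrAC ltr_pdivrMr//.
by rewrite ltr_pM2l ?subr_gt0// /M; have := subr_gt0 (ln s) a; rewrite sa; lra.
Qed.

(** * Log-concave functions of positive mass are bounded below on a cube *)

Section hyperplane.
Variable R : realType.
Local Notation mR := (measurableTypeR R).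
Local Notation leb := (@lebesgue_measure R).
Local Notation T n := (n.-tuple mR).

Definition hyperplane n (v : 'I_n -> R) (b : R) : set (T n) :=
  [set t | (\sum_(i < n) v i * tnth t i = b)%R].

Lemma measurable_hyperplane n (v : 'I_n -> R) b : measurable (hyperplane v b).
Proof.
rewrite -[X in measurable X]setTI.
have -> : hyperplane v b = (fun t => \sum_(i < n) v i * tnth t i)%R @^-1` [set b] by [].
apply: (_ : measurable_fun setT (fun t : T n => (\sum_(i < n) v i * tnth t i)%R : mR)) => //.
apply: measurable_sum => i; apply: measurable_funM => //.
exact: measurable_tnth.
Qed.

Lemma hyperplane_tcons n (v : 'I_n.+1 -> R) b (t : T n) s :
  hyperplane v b (tcons (t, s)) <->
  (v ord0 * s + \sum_(i < n) v (lift ord0 i) * tnth t i = b)%R.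
Proof.
rewrite /hyperplane /mkset big_ord_recl tnth_tcons0.
by under eq_bigr do rewrite tnth_tconsS.
Qed.

(** If the coefficient of the first coordinate is nonzero, every section along it is
    a point; otherwise the hyperplane is a product with the line. *)
Lemma hyperplane_null n (v : 'I_n -> R) b i0 : v i0 != 0%R -> borel_leb R n (hyperplane v b) = 0.
Proof.
elim: n v i0 => [v [] //|n IH v i0 vi0].
have [v00|v00] := eqVneq (v ord0) 0%R.
  case: (unliftP ord0 i0) vi0 => [j|] ->; last by rewrite v00 eqxx.
  move=> vj; rewrite /borel_leb /= /product_step /pushforward.
  have -> : @tcons R n @^-1` hyperplane v b =
      hyperplane (fun i => v (lift ord0 i)) b `*` setT.
    apply/seteqP; split=> -[t s].
      by move=> /hyperplane_tcons; rewrite v00 mul0r add0r.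
    by move=> [h _]; apply/hyperplane_tcons; rewrite v00 mul0r add0r.
  rewrite product_measure1E//; last exact: measurable_hyperplane.
  by have := IH (fun i => v (lift ord0 i)) j vj; rewrite /borel_leb => ->; rewrite mul0e.
have mH := measurable_hyperplane v b.
have := integral_indic (borel_leb R n.+1) measurableT mH; rewrite setIT => <-.
rewrite ge0_integral_tcons; last 2 first.
- exact/measurable_EFinP/measurable_indic.
- by move=> t; rewrite lee_fin indicE ler0n.
apply: integral0_eq => x _.
pose s0 := ((b - \sum_(i < n) v (lift ord0 i) * tnth x i) / v ord0)%R.
transitivity (\int[leb]_(s in [set s0]) (1 : \bar R)); last by rewrite integral_set1.
rewrite [RHS]integral_mkcond; apply: eq_integral => s _.
rewrite patchE indicE.
have -> : (tcons (x, s) \in hyperplane v b) = (s \in [set s0]); last by case: ifP.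
apply/idP/idP; rewrite !inE /s0; [move=> /hyperplane_tcons <-|move=> ->].
 by rewrite /= addrK mulrC mulKf.
by apply/hyperplane_tcons; rewrite mulrC divfK// subrK.
Qed.
End hyperplane.

Lemma convex_sum (R : realType) (V : lmodType R) (S : set V) :
  (forall x y (l : R), (0 < l < 1)%R -> S x -> S y -> S ((1 - l) *: x + l *: y)%R) ->
  forall m (x : 'I_m -> V) (w : 'I_m -> R), (forall i, S (x i)) ->
    (forall i, 0 < w i)%R -> (\sum_i w i = 1)%R -> S (\sum_i w i *: x i)%R.
Proof.
move=> cS; elim => [|m IH] x w Sx w0; first by rewrite big_ord0 => /esym/eqP; rewrite oner_eq0.
rewrite big_ord_recl => w1; rewrite big_ord_recl.
case: m IH x w Sx w0 w1 => [|m] IH x w Sx w0 w1.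
  by move: w1; rewrite !big_ord0 !addr0 => ->; rewrite scale1r.
pose W := (\sum_(i < m.+1) w (lift ord0 i))%R.
have W0 : (0 < W)%R by rewrite /W big_ord_recl ltr_wpDr// sumr_ge0// => i _; rewrite ltW.
have w01 : w ord0 = (1 - W)%R by rewrite -w1 -/W addrK.
have -> : (\sum_(i < m.+1) w (lift ord0 i) *: x (lift ord0 i) =
    W *: \sum_(i < m.+1) (W^-1 * w (lift ord0 i)) *: x (lift ord0 i))%R.
  rewrite scaler_sumr; apply: eq_bigr => i _.
  by rewrite scalerA mulVKf// gt_eqF.
rewrite w01; apply: cS => //; first by rewrite W0/= -subr_gt0 -w01.
apply: IH => [//|i|]; first by rewrite mulr_gt0// invr_gt0.
by rewrite -mulr_sumr mulVf// gt_eqF.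
Qed.

Definition log_concave (R : realType) n (f : n.-tuple (measurableTypeR R) -> \bar R) :=
  forall l : R, (0 < l < 1)%R -> log_comb (@tcomb R n l) l f f f.

Section log_concave.
Variables (R : realType) (n : nat).
Local Notation mR := (measurableTypeR R).
Local Notation Tn := (n.-tuple mR).
Variable f : Tn -> \bar R.
Hypotheses (f0 : forall x, 0 <= f x) (cf : log_concave f).

(** Tuples carry the measure and row vectors the linear structure; [vtuple] and
    [tvec] go from one to the other. *)
Definition vtuple (v : 'rV[R]_n) : Tn := [tuple v ord0 i | i < n].
Definition tvec (t : Tn) : 'rV[R]_n := (\row_i tnth t i)%R.

Lemma tvecK t : vtuple (tvec t) = t.
Proof. by apply/eq_from_tnth => i; rewrite tnth_mktuple mxE. Qed.

Lemma vtupleK v : tvec (vtuple v) = v.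
Proof. by apply/rowP => i; rewrite mxE tnth_mktuple. Qed.

Lemma vtuple_comb l (x y : 'rV[R]_n) :
  vtuple ((1 - l) *: x + l *: y)%R = tcomb l (vtuple x) (vtuple y).
Proof. by apply/eq_from_tnth => i; rewrite !tnth_mktuple !mxE. Qed.

Lemma superlevel_convex c (x y : 'rV[R]_n) (l : R) : (0 < l < 1)%R ->
  (expR c)%:E < f (vtuple x) -> (expR c)%:E < f (vtuple y) ->
  (expR c)%:E < f (vtuple ((1 - l) *: x + l *: y)%R).
Proof.
move=> l01 /lt_dense_real[s cs sx] /lt_dense_real[t ct ty].
pose r := Num.min s t.
have r0 : (0 < r)%R by rewrite lt_min !(lt_trans _ cs, lt_trans _ ct) ?expR_gt0.
have := @cf l l01 (vtuple x) (vtuple y) (ln r) (ln r).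
rewrite lnK ?posrE// => H.
rewrite vtuple_comb; apply: lt_le_trans (H _ _).
- rewrite lte_fin -mulrDl subrK mul1r lnK ?posrE//.
  by rewrite lt_min cs ct.
- by apply: le_lt_trans sx; rewrite lee_fin ge_min lexx.
- by apply: le_lt_trans ty; rewrite lee_fin ge_min lexx orbT.
Qed.

(** Take a maximal family of vectors [y - x0] that are linearly independent, with [x0]
    and the points [y] in the set where [f] is positive.  If there are fewer than
    [n] of them, this set lies in a hyperplane, so [phi] has integral 0.
    Otherwise it contains the vertices of a nondegenerate simplex, on which [f]
    is at least its minimum over the vertices; a cube around the barycentre fits
    inside. *)
Lemma log_concave_cube (phi : Tn -> \bar R) : measurable_fun setT phi ->
  (forall x, 0 <= phi x <= f x) -> 0 < \int[borel_leb R n]_x phi x ->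
  exists c x0 e, (0 < e)%R /\ forall x, cube x0 e x -> (expR c)%:E < f x.
Proof.
move=> mphi phif Iphi.
pose D := [set v : 'rV[R]_n | 0 < f (vtuple v)].
have [x0 Dx0] : exists x0, D x0.
  apply: contrapT => H; move: Iphi; rewrite integral0_eq ?ltxx// => x _.
  apply/eqP; rewrite eq_le; have /andP[-> pf] := phif x; rewrite andbT.
  apply: le_trans pf _; rewrite leNgt; apply/negP => fx.
  by apply: H; exists (tvec x); rewrite /D/= tvecK.
pose P r := `[< exists A : 'M[R]_(r, n), row_free A /\ forall i, D (x0 + row i A)%R >].
have P0 : exists r, P r.
  exists 0%N; apply/asboolP; exists 0%R; split; last by case.
  by rewrite /row_free mxrank0.
have Pn r : P r -> (r <= n)%N.
  by move=> /asboolP[A [/eqP rA _]]; rewrite -rA rank_leq_col.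
case: (ex_maxnP P0 Pn) => r /asboolP[A [freeA DA]] rmax.
have span y : D y -> ((y - x0)%R <= A)%MS.
  move=> Dy; apply: contrapT => /negP nA.
  suff : (r.+1 <= r)%N by rewrite ltnn.
  apply: rmax; apply/asboolP; exists (col_mx (y - x0)%R A : 'M[R]_((1 + r)%N, n)); split.
    have : (A < col_mx (y - x0)%R A)%MS.
      rewrite /ltmx -addsmxE addsmxSr/=; apply: contra nA.
      by rewrite -addsmxE => /(submx_trans _); apply; exact: addsmxSl.
    rewrite ltmxErank (eqP freeA) => /andP[_ rlt].
    by rewrite /row_free eqn_leq rank_leq_row.
  suff H : forall i : 'I_(1 + r)%N, D (x0 + row i (col_mx (y - x0) A))%R by exact: H.
  move=> i; rewrite -(@fintype.splitK 1%N r i); case: (@fintype.split 1%N r i) => j /=.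
    by rewrite rowKu (ord1 j) (_ : row _ _ = y - x0)%R ?subrKC//; apply/rowP => k; rewrite !mxE.
  by rewrite rowKd.
have [rn|] := ltnP r n.
  have /matrix0Pn[k [j Ckj]] : cokermx A != 0%R.
    by rewrite -mxrank_eq0 mxrank_coker (eqP freeA) subn_eq0 -ltnNge.
  pose v i := cokermx A i j.
  pose b := (\sum_i v i * x0 ord0 i)%R.
  have sub t : 0 < f t -> hyperplane v b t.
    move=> ft; have := span (tvec t); rewrite /D/= tvecK => /(_ ft).
    rewrite submxE mulmxBl subr_eq0 => /eqP/matrixP/(_ ord0 j).
    rewrite !mxE /hyperplane/= /b => E.
    transitivity (\sum_i tvec t ord0 i * cokermx A i j)%R.
      by apply: eq_bigr => i _; rewrite mulrC mxE.
    by rewrite E; apply: eq_bigr => i _; rewrite mulrC.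
  move: Iphi; suff -> : \int[borel_leb R n]_x phi x = 0 by rewrite ltxx.
  transitivity (\int[borel_leb R n]_(x in hyperplane v b) phi x).
    rewrite [RHS]integral_mkcond; apply: eq_integral => t _.
    rewrite patchE; case: ifPn => // /negP; rewrite inE => nH.
    apply/eqP; rewrite eq_le; have /andP[-> pf] := phif t; rewrite andbT.
    by apply: le_trans pf _; rewrite leNgt; apply/negP => /sub.
  apply: null_set_integral; first exact: measurable_hyperplane.
    exact: measurable_funTS.
  exact: (hyperplane_null _ (i0 := k)).
move=> nr; have {nr} rn : r = n by apply/eqP; rewrite eqn_leq nr Pn//; apply/asboolP; exists A.
subst r.
have uA : A \in unitmx by rewrite -row_free_unit.
pose B := invmx A.
pose x (i : 'I_n.+1) := if unlift ord0 i is Some j then (x0 + row j A)%R else x0.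
have Dx i : D (x i) by rewrite /x; case: unliftP => [j|] _; [exact: DA|exact: Dx0].
have [c cx] : exists c, forall i, (expR c)%:E < f (vtuple (x i)).
  have H i : exists s, (0 < s)%R /\ s%:E < f (vtuple (x i)).
    by have /lt_dense_real[s s0 sf] := Dx i; exists s.
  have [s Hs] := choice H.
  pose m := \big[Num.min/1%R]_(i < n.+1) s i.
  have m0 : (0 < m)%R.
    by apply: (big_ind (fun z : R => 0 < z)%R) => //= [a b a0 b0|i _]; [rewrite lt_min a0|case: (Hs i)].
  exists (ln m) => i; rewrite lnK ?posrE//; apply: le_lt_trans (Hs i).2.
  by rewrite lee_fin; apply: bigmin_le_cond.
pose K := (\sum_i \sum_j `|B i j|)%R.
have K0 : (0 <= K)%R by apply: sumr_ge0 => i _; apply: sumr_ge0 => j _.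
(* The barycentric coordinates of the barycentre are [N^-1]; a point of the cube
   of radius [e] around it has coordinates within [e * K < N^-1] of that. *)
pose N := (n.+1%:R : R).
have N0 : (0 < N)%R by rewrite ltr0n.
pose e := (N * (K + 1))^-1%R.
have e0 : (0 < e)%R by rewrite invr_gt0 mulr_gt0// ltr_wpDl.
have eK : (e * K < N^-1)%R.
  rewrite /e mulrC ltr_pdivrMr ?mulr_gt0 ?ltr_wpDl//.
  by rewrite mulKf ?gt_eqF// ltrDl.
pose c0 := (x0 + (const_mx N^-1 : 'rV_n) *m A)%R.
exists c, (vtuple c0), e; split => // t /cubeP ct.
pose d := (tvec t - c0)%R.
have dle i : (`|d ord0 i| <= e)%R.
  by have := ct i; rewrite tnth_mktuple !mxE => /ltW.
pose w := (const_mx N^-1 + d *m B)%R.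
have wA : tvec t = (x0 + w *m A)%R.
  by rewrite /w mulmxDl mulmxKV// addrA -/c0 /d subrKC.
have sumle (F : 'I_n -> R) : (forall j, F j = (d *m B)%R ord0 j) ->
    (\sum_j `|F j| <= e * K)%R.
  move=> FE; rewrite /K exchange_big mulr_sumr/=; apply: ler_sum => j _.
  rewrite FE mxE mulr_sumr; apply: le_trans (ler_norm_sum _ _ _) _.
  by apply: ler_sum => i _; rewrite normrM ler_wpM2r.
have dB_le := sumle _ (fun=> erefl).
have dB1 j : (`|(d *m B)%R ord0 j| < N^-1)%R.
  apply: le_lt_trans eK; apply: le_trans dB_le.
  by rewrite (bigD1 j)//= lerDl sumr_ge0.
pose wt (i : 'I_n.+1) := if unlift ord0 i is Some j then w ord0 j else (1 - \sum_j w ord0 j)%R.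
have wtS j : wt (lift ord0 j) = w ord0 j by rewrite /wt liftK.
have wt0 : wt ord0 = (1 - \sum_j w ord0 j)%R by rewrite /wt unlift_none.
have xS j : x (lift ord0 j) = (x0 + row j A)%R by rewrite /x liftK.
have x00 : x ord0 = x0 by rewrite /x unlift_none.
have E : tvec t = (\sum_i wt i *: x i)%R.
  rewrite big_ord_recl; under eq_bigr do rewrite wtS xS scalerDr.
  rewrite wt0 x00 big_split/= -scaler_suml addrA -scalerDl subrK scale1r wA; congr (_ + _)%R.
  by rewrite mulmx_sum_row.
rewrite -[t]tvecK E.
apply: (convex_sum (S := [set v | (expR c)%:E < f (vtuple v)])) => //.
- by move=> y z l l01; exact: superlevel_convex.
- move=> i; rewrite /wt; case: unliftP => [j|] _.
    rewrite !mxE; have := dB1 j; rewrite ltr_norml mxE => /andP[+ _].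
    by rewrite -subr_gt0 opprK addrC.
  have -> : (\sum_j w ord0 j = n%:R * N^-1 + \sum_j (d *m B) ord0 j)%R.
    under eq_bigr do rewrite mxE; rewrite big_split/=; congr (_ + _)%R.
    under eq_bigr do rewrite mxE.
    by rewrite sumr_const card_ord mulr_natl.
  have : (\sum_j (d *m B)%R ord0 j < N^-1)%R.
    apply: le_lt_trans eK; apply: le_trans dB_le; apply: ler_sum => j _.
    exact: ler_norm.
  have : (n%:R * N^-1 = 1 - N^-1)%R.
    have H : ((n%:R + 1) * N^-1 = 1)%R by rewrite natr1 divff// gt_eqF.
    by move: H; rewrite mulrDl mul1r => /(canRL (addrK _)).
  by move=> -> SN; rewrite subr_gt0 -ltrBrDl opprB addrC subrK.
- by rewrite big_ord_recl; under eq_bigr do rewrite wtS; rewrite wt0 subrK.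
Qed.

(** Together with [lower_envelope_le]: a log-concave function and its envelope have
    the same lower integral.  If [f > e^c] on a cube, moving [x] towards a point of the
    cube by a ratio [l] gives, for every Borel [phi <= f],
    [e^((1 - l) a + l b) <= \int lower_envelope f] as soon as [e^a < \int phi], where
    [e^b] is less than [e^c] times the volume of a smaller cube; then [l] tends to 0. *)
Lemma integral_le_lower_envelope (phi : Tn -> \bar R) : measurable_fun setT phi ->
  (forall x, 0 <= phi x <= f x) ->
  \int[borel_leb R n]_x phi x <= \int[borel_leb R n]_x lower_envelope f x.
Proof.
move=> mphi phif.
have env0 x : 0 <= lower_envelope f x by apply: (@lower_envelope_ge _ _ _ _ _ 1%R).
have phi0 x : 0 <= phi x by have /andP[] := phif x.
apply: le_of_expR_lt; last exact: integral_ge0.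
move=> a aphi.
have [c [x0 [e [e0 cubef]]]] : exists c x0 e, (0 < e)%R /\ forall x, cube x0 e x -> (expR c)%:E < f x.
  apply: (log_concave_cube mphi phif); apply: lt_trans aphi.
  by rewrite lte_fin expR_gt0.
(* half the radius, so that a cube around any point of [C] fits in the cube
   where [f] is bounded below *)
pose C := cube x0 (e / 2)%R.
have e20 : (0 < e / 2)%R by rewrite divr_gt0.
have mC : measurable C by exact: measurable_cube.
pose g x : \bar R := (expR c * \1_C x)%:E.
have mg : measurable_fun setT g by apply/measurable_EFinP/measurable_funM => //; exact: measurable_indic.
have Ig : \int[borel_leb R n]_x g x = (expR c * (2 * (e / 2)) ^+ n)%:E.
  rewrite /g; under eq_integral do rewrite EFinM.
  rewrite ge0_integralZl//=; last exact/measurable_EFinP/measurable_indic.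
  rewrite integral_indic// setIT EFinM; congr (_ * _).
  exact: borel_leb_cube.
pose V := (expR c * (2 * (e / 2)) ^+ n)%R.
have V0 : (0 < V)%R by rewrite mulr_gt0 ?expR_gt0// exprn_gt0// mulr_gt0.
apply: (@expR_le_of_log_comb _ a (ln V - 1)%R) => l l01.
apply: (prekopa_leindler l01 mphi mg (measurable_lower_envelope f) phi0 _ env0).
- by move=> x; rewrite lee_fin mulr_ge0// ?expR_ge0// indicE ler0n.
- move=> x y a' b' aphi' bg.
  have [Cy bc] : C y /\ (expR b' < expR c)%R.
    move: bg; rewrite /g indicE; have [Cy|nC] := pselect (C y).
      by rewrite mem_set// mulr1 lte_fin.
    by rewrite memNset// mulr0 lte_fin ltNge expR_ge0.
  apply: (lower_envelope_log_comb (cf l01) l01 e20).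
    by apply: lt_le_trans aphi' _; have /andP[] := phif x.
  move=> z yz; apply: (lt_trans _ (cubef _ _)); first by rewrite lte_fin.
  by have := cube_sub Cy yz; rewrite -splitr.
- exact: aphi.
- by rewrite Ig lte_fin -/V -[ltRHS]lnK ?posrE// ltr_expR ltrBlDr ltrDl.
Qed.

End log_concave.

(** * Integrability of exponentially decreasing functions *)

Section exponential_decay.
Variable R : realType.
Local Notation mR := (measurableTypeR R).
Local Notation leb := (@lebesgue_measure R).
Local Notation T n := (n.-tuple mR).

(** By symmetry, twice the integral over the half-line, where the integrand is the
    density of the exponential law. *)
Lemma integral_expR_abs_lty : \int[leb]_s (expR (- `|s|))%:E < +oo.
Proof.
rewrite ge0_symfun_integralT; last 3 first.
- by move=> x; exact: expR_ge0.
- move=> x; apply: continuous_comp; last exact: continuous_expR.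
  by apply: cvgN; exact: norm_continuous.
- by move=> x /=; rewrite normrN.
have mE : measurable_fun setT (fun x : mR => (expR (- `|x|))%:E : \bar R).
  apply/measurable_EFinP; apply: measurableT_comp => //; apply: measurableT_comp => //.
have m0 : measurable [set x : mR | (0 <= x)%R].
  have -> : [set x : mR | (0 <= x)%R] = `[0%R, +oo[%classic.
    by apply/seteqP; split=> x /=; rewrite in_itv/= andbT.
  exact: measurable_itv.
have mpdf : measurable_fun setT (fun x : mR => (exponential_pdf 1%R x)%:E : \bar R).
  by apply/measurable_EFinP; exact: measurable_exponential_pdf.
have pdf0 (x : R) : (0 <= exponential_pdf 1 x)%R by exact: exponential_pdf_ge0.
apply: (@le_lt_trans _ _ (2 * \int[leb]_x (exponential_pdf 1%R x)%:E)).
  rewrite lee_pmul2l//.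
  apply: (@le_trans _ _ (\int[leb]_(x in [set x : mR | (0 <= x)%R]) (exponential_pdf 1%R x)%:E)).
    apply: ge0_le_integral => //; try exact: measurable_funTS.
    by move=> x /= x0; rewrite lee_fin exponential_pdfE// mul1r mulN1r ger0_norm.
  by apply: ge0_subset_integral => // x _; rewrite lee_fin.
by rewrite integral_exponential_pdf// mule1 ltry.
Qed.

Definition l1dist n (x y : T n) : R := (\sum_(i < n) `|tnth y i - tnth x i|)%R.

Lemma l1dist_tcons n (x y : T n) (c s : R) :
  l1dist (tcons (x, c)) (tcons (y, s)) = (`|s - c| + l1dist x y)%R.
Proof.
rewrite /l1dist big_ord_recl !tnth_tcons0; congr (_ + _)%R.
by apply: eq_bigr => i _; rewrite !tnth_tconsS.
Qed.

Lemma measurable_exp_l1dist n (x : T n) (r : R) :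
  measurable_fun setT (fun y : T n => (expR (- (l1dist x y / r)))%:E : \bar R).
Proof.
apply/measurable_EFinP; apply: measurableT_comp => //; apply: measurableT_comp => //.
apply: measurable_funM => //; apply: measurable_sum => i.
apply: measurableT_comp => //; apply: measurable_funB => //.
exact: measurable_tnth.
Qed.

Lemma integral_exp_l1dist_lty n (x : T n) (r : R) : (0 < r)%R ->
  \int[borel_leb R n]_y (expR (- (l1dist x y / r)))%:E < +oo.
Proof.
move=> r0; elim: n x => [|n IH] x.
  by rewrite integral_tuple0 ?ltry//; exact: measurable_exp_l1dist.
have [x' [c ->]] := tcons_surj x.
rewrite ge0_integral_tcons; last 2 first.
- exact: measurable_exp_l1dist.
- by move=> y; rewrite lee_fin expR_ge0.
pose I := \int[leb]_s (expR (- (`|s - c| / r)))%:E.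
have mI : measurable_fun setT (fun s : mR => (expR (- `|s|))%:E : \bar R).
  by apply/measurable_EFinP; apply: measurableT_comp => //; apply: measurableT_comp.
have Iy : I < +oo.
  have -> : I = \int[leb]_s (expR (- `|r^-1 * s + (- (r^-1 * c))|))%:E.
    apply: eq_integral => s _; congr (expR (- _))%:E.
    by rewrite -mulrBr normrM gtr0_norm ?invr_gt0// mulrC.
  rewrite (@ge0_integral_affine _ _ _ (fun s => (expR (- `|s|))%:E)) ?invr_gt0//.
  by rewrite invrK lte_mul_pinfty ?lee_fin ?(ltW r0)// integral_expR_abs_lty.
have I0 : 0 <= I by apply: integral_ge0 => s _; rewrite lee_fin expR_ge0.
have ms : measurable_fun setT (fun s : mR => (expR (- (`|s - c| / r)))%:E : \bar R).
  apply/measurable_EFinP; apply: measurableT_comp => //; apply: measurableT_comp => //.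
  apply: measurable_funM => //; apply: measurableT_comp => //; exact: measurable_funB.
under eq_integral => y _.
  under eq_integral do rewrite l1dist_tcons mulrDl opprD addrC expRD EFinM.
  rewrite ge0_integralZl//=.
  rewrite -/I muleC.
  over.
rewrite /= ge0_integralZl//=; last exact: measurable_exp_l1dist.
by rewrite lte_mul_pinfty// ge0_fin_numE.
Qed.

End exponential_decay.

(** * The total mass as a lower integral over Borel functions *)

Section total_mass.
Variables (R : realType) (n : nat).
Local Notation mR := (measurableTypeR R).
Local Notation Tn := (n.-tuple mR).
Implicit Types f g : 'rV[R]_n -> \bar R.

Lemma J_ge (phi : Tn -> \bar R) f : measurable_fun setT phi ->
  (forall t, 0 <= phi t) -> (forall t, phi t <= f (tvec t)) ->
  \int[borel_leb R n]_t phi t <= J f.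
Proof. by move=> *; exact: integral_completed_ge. Qed.

Lemma J_approx f (r : \bar R) : (forall x, 0 <= f x) -> r < J f ->
  exists phi : Tn -> \bar R, [/\ measurable_fun setT phi,
    forall t, 0 <= phi t <= f (tvec t) & r < \int[borel_leb R n]_t phi t].
Proof.
move=> f0 rJ; apply: (integral_completed_approx (@borel_lebesgue_sigma_finite R n)) => //.
Qed.

Lemma J_le (psi : Tn -> \bar R) f : measurable_fun setT psi ->
  (forall x, 0 <= f x) -> (forall t, f (tvec t) <= psi t) -> J f <= \int[borel_leb R n]_t psi t.
Proof.
move=> mpsi f0 fpsi; rewrite leNgt; apply/negP => /(J_approx f0)[phi [mphi phif]].
apply/negP; rewrite -leNgt; apply: ge0_le_integral => //.
- by move=> t _; have /andP[] := phif t.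
- by move=> t _; have /andP[_ /le_trans] := phif t; apply.
Qed.

Lemma J_ge0 f : (forall x, 0 <= f x) -> 0 <= J f.
Proof. by move=> f0; apply: integral_ge0. Qed.

End total_mass.

(** * Growth of convex functions *)

Section convex_growth.
Variables (R : realType) (n : nat).
Local Notation Rn := ('rV[R]_n).
Local Notation Tn := (n.-tuple (measurableTypeR R)).
Implicit Types (u : Rn -> \bar R) (x y z : Rn).

Lemma lt_expR_expeR (a : R) (s : \bar R) : ((expR a)%:E < expeR (- s)) = (s < (- a)%:E).
Proof.
by rewrite -[(expR a)%:E]/(expeR a%:E) lte_expeR lteNr EFinN.
Qed.

Lemma convex_fun01 u x y (a : R) : convex_fun u -> (0 <= a <= 1)%R ->
  u (a *: x + (1 - a) *: y)%R <= a%:E * u x + (1 - a)%:E * u y.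
Proof.
move=> cu /andP[]; rewrite [X in is_true X -> _]le_eqVlt => /orP[/eqP <- _|a0].
  by rewrite scale0r add0r mul0e add0e subr0 scale1r mul1e lexx.
rewrite [X in is_true X -> _]le_eqVlt => /orP[/eqP ->|a1]; last by apply: cu; rewrite a0.
by rewrite subrr scale0r addr0 mul0e adde0 scale1r mul1e lexx.
Qed.

(** Strict inequalities between real bounds avoid the sums of extended reals of
    [convex_fun]. *)
Lemma convex_fun_lt u x y (l a b : R) : convex_fun u -> (0 < l < 1)%R ->
  u x < a%:E -> u y < b%:E ->
  u ((1 - l) *: x + l *: y)%R < ((1 - l) * a + l * b)%:E.
Proof.
move=> cu /andP[l0 l1] xa yb.
have l1' : (0 < 1 - l)%R by rewrite subr_gt0.
have := cu x y (1 - l)%R; rewrite subKr => /(_ _)/le_lt_trans; apply.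
  by rewrite l1' /= ltrBlDr ltrDl.
rewrite (EFinD ((1 - l) * a)%R) (EFinM (1 - l)%R) (EFinM l).
by apply: lteD; rewrite lte_pmul2l// lte_fin.
Qed.

Definition l1norm x : R := (\sum_(i < n) `|x ord0 i|)%R.

Lemma l1norm_ge0 x : (0 <= l1norm x)%R.
Proof. by apply: sumr_ge0. Qed.

Lemma l1normZ (a : R) x : l1norm (a *: x) = (`|a| * l1norm x)%R.
Proof. by rewrite /l1norm mulr_sumr; apply: eq_bigr => i _; rewrite mxE normrM. Qed.

Lemma le_l1norm x i : (`|x ord0 i| <= l1norm x)%R.
Proof. by rewrite /l1norm (bigD1 i)//= lerDl sumr_ge0. Qed.

Lemma l1norm_le_euclid x : (l1norm x <= n%:R * euclid_norm x)%R.
Proof.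
rewrite mulr_natl -[X in (_ *+ X)%R]card_ord -sumr_const; apply: ler_sum => i _.
rewrite -sqrtr_sqr ler_sqrt; last by apply: sumr_ge0 => j _; exact: sqr_ge0.
by rewrite (bigD1 i)//= lerDl sumr_ge0// => j _; exact: sqr_ge0.
Qed.

Lemma l1normB_le x y : (l1norm y - l1norm x <= l1norm (x + y))%R.
Proof.
rewrite lerBlDr /l1norm -big_split/=; apply: ler_sum => i _.
have -> : (y ord0 i = (x + y)%R ord0 i - x ord0 i)%R by rewrite mxE addrAC subrr add0r.
exact: ler_normB.
Qed.

(** If [u <= M] near [x0], reflecting a small multiple of [y - x0] through [x0] shows
    that [u] cannot be too negative at [y]. *)
Lemma convex_lower_bound u x0 (e M : R) : convex_fun u -> (forall x, -oo < u x) ->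
  (0 < e)%R -> (forall x, (l1norm (x - x0) < e)%R -> u x < M%:E) ->
  exists A B : R, (0 <= B)%R /\ forall y, (A - B * l1norm (y - x0))%:E <= u y.
Proof.
move=> cu uNy e0 uM.
have u0M : u x0 < M%:E.
  by apply: uM; rewrite subrr /l1norm big1// => i _; rewrite mxE normr0.
have u0f : u x0 \is a fin_num by rewrite fin_numE gt_eqF ?uNy// lt_eqF// (lt_trans u0M) ?ltry.
set m := fine (u x0); have um : u x0 = m%:E by rewrite fineK.
have mM : (m < M)%R by rewrite -lte_fin -um.
exists (m - 2 * (M - m) / e)%R, (2 * (M - m) / e)%R; split.
  by apply: divr_ge0; [apply: mulr_ge0; rewrite // subr_ge0 ltW|exact: ltW].
move=> y; rewrite leNgt; apply/negP => uy.
set N := l1norm (y - x0) in uy.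
have N0 : (0 <= N)%R by exact: l1norm_ge0.
pose s := (e / (2 * (1 + N)))%R.
have s0 : (0 < s)%R by rewrite divr_gt0// mulr_gt0// ltr_wpDr.
pose y' := (x0 - s *: (y - x0))%R.
have uy' : u y' < M%:E.
  apply: uM; rewrite /y' addrAC subrr add0r -scaleNr l1normZ normrN gtr0_norm//.
  rewrite -/N /s mulrAC ltr_pdivrMr ?mulr_gt0 ?ltr_wpDr// ltr_pM2l//; lra.
pose l := (s / (1 + s))%R.
have s1 : (0 < 1 + s)%R by rewrite addr_gt0.
have l01 : (0 < l < 1)%R by rewrite divr_gt0//= ltr_pdivrMr// mul1r ltrDr.
have := convex_fun_lt cu l01 uy' uy.
have -> : ((1 - l) *: y' + l *: y = x0)%R.
  have -> : (1 - l = (1 + s)^-1)%R by rewrite /l; field; rewrite gt_eqF.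
  apply: (@scalerI _ _ (1 + s)%R); first by rewrite gt_eqF.
  rewrite scalerDr !scalerA divff ?gt_eqF// scale1r /l mulrCA divff ?gt_eqF// mulr1.
  by rewrite /y' scalerBr opprB addrA subrK scalerDl scale1r.
rewrite um lte_fin ltNge; apply/negP; rewrite negbK.
rewrite (_ : (1 - l) * M + _ = m)%R//.
rewrite /l /s; field.
by rewrite !gt_eqF//; lra.
Qed.

(** On a large sphere around [x0], [u] exceeds [u x0 + 1]; by convexity along rays it
    grows at least linearly outside. *)
Lemma convex_coercive_growth u x0 (e M : R) : convex_fun u -> (forall x, -oo < u x) ->
  cvg_pinfty_at_infty u ->
  (0 < e)%R -> (forall x, (l1norm (x - x0) < e)%R -> u x < M%:E) ->
  exists r C : R, (0 < r)%R /\ forall y, (l1norm (y - x0) / r - C)%:E <= u y.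
Proof.
move=> cu uNy uy e0 uM.
have [A [B [B0 lb]]] := convex_lower_bound cu uNy e0 uM.
have u0M : u x0 < M%:E.
  by apply: uM; rewrite subrr /l1norm big1// => i _; rewrite mxE normr0.
have u0f : u x0 \is a fin_num by rewrite fin_numE gt_eqF ?uNy// lt_eqF// (lt_trans u0M) ?ltry.
set m := fine (u x0); have um : u x0 = m%:E by rewrite fineK.
have [r ur] := uy (m + 1)%R.
pose rho := (n%:R * `|r| + l1norm x0 + 1)%R.
have rho0 : (0 < rho)%R.
  by rewrite ltr_wpDl// addr_ge0 ?l1norm_ge0// mulr_ge0.
have far p : l1norm (p - x0) = rho -> (m + 1)%:E < u p.
  move=> pr; apply: ur; rewrite ltNge; apply/negP => pr'.
  have := l1norm_le_euclid p.
  have : (n%:R * euclid_norm p <= n%:R * `|r|)%R.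
    by rewrite ler_wpM2l// (le_trans pr')// ler_norm.
  have := l1normB_le x0 (p - x0); rewrite (addrC x0) subrK pr /rho; lra.
exists rho, (`|A| + B * rho + 1 + `|m|)%R; split=> // y.
set N := l1norm (y - x0).
have N0 : (0 <= N)%R by exact: l1norm_ge0.
have Brho : (0 <= B * rho)%R by rewrite mulr_ge0// ltW.
have A1 := ler_norm (- A)%R; rewrite normrN in A1.
have m1 := ler_norm (- m)%R; rewrite normrN in m1.
have A0 := normr_ge0 A; have m0 := normr_ge0 m.
have [Nr|rN] := leP N rho.
  apply: le_trans (lb y); rewrite lee_fin -/N.
  have : (N / rho <= 1)%R by rewrite ler_pdivrMr// mul1r.
  have : (B * N <= B * rho)%R by rewrite ler_wpM2l.
  lra.
rewrite leNgt; apply/negP => uyN.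
pose l := (rho / N)%R.
have Np : (0 < N)%R by exact: lt_trans rN.
have l01 : (0 < l < 1)%R by rewrite divr_gt0//= ltr_pdivrMr// mul1r.
have := far ((1 - l) *: x0 + l *: y)%R.
have -> : ((1 - l) *: x0 + l *: y - x0 = l *: (y - x0))%R.
  by rewrite scalerBl scale1r scalerBr addrC !addrA (addrC (- x0)%R) subrr add0r addrC.
rewrite l1normZ gtr0_norm ?(andP l01).1// -/N divfK ?gt_eqF// => /(_ erefl).
(* [convex_fun_lt] needs a strict bound; this one is small enough to be absorbed
   in the last line *)
have u0m : u x0 < (m + (1 - l)^-1 * (l / 2))%:E.
  have /andP[l0 l1] := l01.
  by rewrite um lte_fin ltrDl mulr_gt0 ?divr_gt0 ?invr_gt0 ?subr_gt0.
move=> /lt_trans/(_ (convex_fun_lt cu l01 u0m uyN)).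
rewrite lte_fin mulrDr mulVKf; last by rewrite gt_eqF// subr_gt0; case/andP: l01.
have -> : (l * (N / rho - (`|A| + B * rho + 1 + `|m|)) =
    1 - l * (`|A| + B * rho + 1 + `|m|))%R.
  rewrite mulrBr; congr (_ - _)%R; rewrite /l mulrA divfK ?gt_eqF// divff// gt_eqF//.
set C := (_ + `|m|)%R => H.
have /andP[l0 l1] := l01.
have : (l * (m + C) < l * 2^-1)%R by lra.
rewrite ltr_pM2l// /C; lra.
Qed.

End convex_growth.

(** * Log-concavity of the perturbed mass *)

Lemma cube_open (R : realType) n (c x : n.-tuple (measurableTypeR R)) (e : R) : cube c e x ->
  exists2 d, (0 < d)%R & cube x d `<=` cube c e.
Proof.
move=> /cubeP cx.
pose d := \big[Num.min/1%R]_(i < n) (e - `|tnth x i - tnth c i|)%R.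
exists d.
  apply: (big_ind (fun z : R => (0 < z)%R)) => //= [a b a0 b0|i _].
    by rewrite lt_min a0.
  by rewrite subr_gt0.
move=> y /cubeP xy; apply/cubeP => i.
have -> : (tnth y i - tnth c i = (tnth x i - tnth c i) + (tnth y i - tnth x i))%R by ring.
apply: le_lt_trans (ler_normD _ _) _; rewrite -ltrBrDl.
by apply: lt_le_trans (xy i) _; exact: bigmin_le_cond.
Qed.

Lemma lower_envelope_gt (R : realType) n (f : n.-tuple (measurableTypeR R) -> \bar R) (a : \bar R) x :
  a < lower_envelope f x ->
  exists2 d, (0 < d)%R & forall y, cube x d y -> a < f y.
Proof.
move=> /ereal_sup_gt[_ [q qx <-] aq].
have [d d0 dq] := cube_open qx.
exists d => // y /dq qy; apply: lt_le_trans aq _.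
by apply: ereal_inf_lbound; exists y.
Qed.

Section perturbation.
Variables (R : realType) (n : nat).
Local Notation Rn := ('rV[R]_n).
Local Notation Tn := (n.-tuple (measurableTypeR R)).
Variables u v : Rn -> \bar R.
Hypotheses (uNy : forall x, -oo < u x) (vNy : forall x, -oo < v x).
Hypotheses (cu : convex_fun u) (cv : convex_fun v).

(** The infimal convolution of [u] with [v] rescaled by [t], after the change of
    variable [y = t w].  In this form it makes sense at [t = 0] too, where it is
    [u]. *)
Definition pert (t : R) (x : Rn) : \bar R :=
  ereal_inf [set u (x - t *: w)%R + t%:E * v w | w in [set: Rn]].

Lemma pert_lt t x a : pert t x < a -> exists w, u (x - t *: w)%R + t%:E * v w < a.
Proof. by move=> /ereal_inf_lt[_ [w _ <-]]; exists w. Qed.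

Lemma pert_le t x w : pert t x <= u (x - t *: w)%R + t%:E * v w.
Proof. by apply: ereal_inf_lbound; exists w. Qed.

Lemma pert0 x : pert 0 x = u x.
Proof.
rewrite /pert (_ : [set _ | _ in _] = [set u x]) ?ereal_inf1 //.
have E w : u (x - 0 *: w)%R + 0%:E * v w = u x by rewrite scale0r subr0 mul0e adde0.
by apply/seteqP; split=> [_ [w _ <-]|_ ->]; [rewrite E|exists 0%R].
Qed.

(** Joint convexity of the perspective [(y, t) |-> t v (y / t)], stated without
    division so as to include [a = 0] or [b = 0]. *)
Lemma perspective_convex (a b l : R) (w1 w2 : Rn) : (0 <= a)%R -> (0 <= b)%R -> (0 < l < 1)%R ->
  exists w, (((1 - l) * a + l * b) *: w = ((1 - l) * a) *: w1 + (l * b) *: w2)%R /\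
    ((1 - l) * a + l * b)%:E * v w <= ((1 - l) * a)%:E * v w1 + (l * b)%:E * v w2.
Proof.
move=> a0 b0 /andP[l0 l1].
have l1' : (0 < 1 - l)%R by rewrite subr_gt0.
set p := ((1 - l) * a)%R; set q := (l * b)%R.
have p0 : (0 <= p)%R by rewrite mulr_ge0// ltW.
have q0 : (0 <= q)%R by rewrite mulr_ge0// ltW.
have [c0|c0] := eqVneq (p + q)%R 0%R.
  exists w1; move/eqP: c0; rewrite paddr_eq0// => /andP[/eqP -> /eqP ->].
  by rewrite addr0 !scale0r addr0 !mul0e adde0.
have cp : (0 < p + q)%R by rewrite lt_neqAle eq_sym c0 addr_ge0.
pose th := (p / (p + q))%R.
have th01 : (0 <= th <= 1)%R.
  by rewrite divr_ge0 ?(ltW cp)//= ler_pdivrMr// mul1r lerDl.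
have thp : ((p + q) * th = p)%R by rewrite mulrC divfK.
have thq : ((p + q) * (1 - th) = q)%R by rewrite mulrBr mulr1 thp addrC addKr.
exists (th *: w1 + (1 - th) *: w2)%R; split.
  by rewrite scalerDr !scalerA thp thq.
apply: (@le_trans _ _ ((p + q)%:E * (th%:E * v w1 + (1 - th)%:E * v w2))).
  by rewrite lee_pmul2l//; exact: convex_fun01.
have nny (r : R) (s : \bar R) : (0 <= r)%R -> -oo < s -> r%:E * s != -oo.
  rewrite le_eqVlt => /orP[/eqP <-|r0 sNy]; first by rewrite mul0e.
  by case: s sNy => // _; rewrite gt0_muley ?lte_fin.
have /andP[th0 th1] := th01.
rewrite muleDr//; last first.
  by rewrite /adde_def !negb_and !nny ?subr_ge0// !orbT.
by rewrite !muleA -!EFinM thp thq.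
Qed.

Lemma pert_comb (a b l : R) x y (s t : R) : (0 <= a)%R -> (0 <= b)%R -> (0 < l < 1)%R ->
  pert a x < s%:E -> pert b y < t%:E ->
  pert ((1 - l) * a + l * b) ((1 - l) *: x + l *: y) < ((1 - l) * s + l * t)%:E.
Proof.
move=> a0 b0 l01 /pert_lt[w1 h1] /pert_lt[w2 h2].
have /andP[l0 l1] := l01.
have l1' : (0 < 1 - l)%R by rewrite subr_gt0.
have [w [wE wle]] := perspective_convex w1 w2 a0 b0 l01.
apply: le_lt_trans (pert_le _ _ w) _.
have -> : ((1 - l) *: x + l *: y - ((1 - l) * a + l * b) *: w =
   (1 - l) *: (x - a *: w1) + l *: (y - b *: w2))%R.
  by rewrite wE !scalerBr !scalerA opprD addrACA.
move: h1 h2 wle; rewrite (EFinM (1 - l)%R a) (EFinM l b) -!muleA.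
set U1 := u (x - _)%R; set U2 := u (y - _)%R; set q1 := _ * v w1; set q2 := _ * v w2.
move=> h1 h2 wle.
have split2 (U q : \bar R) r : -oo < U -> -oo < q -> U + q < r%:E ->
    exists2 p, U < p%:E & q < (r - p)%:E.
  case: U q => [U| |] [q| |]//= _ _; rewrite ?addye ?addey// => Uqr.
  move: Uqr; rewrite -EFinD lte_fin => Uqr.
  by exists (U + (r - (U + q)) / 2)%R; rewrite lte_fin; lra.
have qNy (r : R) w0 : (0 <= r)%R -> -oo < r%:E * v w0.
  rewrite le_eqVlt => /orP[/eqP <-|r0]; first by rewrite mul0e ltNy0.
  by have := vNy w0; case: (v w0) => [z| |] // _; rewrite ?gt0_muley ?lte_fin// ltNyr.
have [p1 U1p q1p] := split2 _ _ _ (uNy _) (qNy _ _ a0) h1.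
have [p2 U2p q2p] := split2 _ _ _ (uNy _) (qNy _ _ b0) h2.
have -> : ((1 - l) * s + l * t = ((1 - l) * p1 + l * p2) + ((1 - l) * (s - p1) + l * (t - p2)))%R.
  by ring.
rewrite [ltRHS]EFinD; apply: lteD; first exact: convex_fun_lt.
apply: (le_lt_trans wle).
rewrite (EFinD ((1 - l) * _)%R) (EFinM (1 - l)%R) (EFinM l).
by apply: lteD; rewrite lte_pmul2l// lte_fin.
Qed.

Definition pert_density t (s : Tn) : \bar R := expeR (- pert t (tvec s)).

Lemma pert_density_comb (a b l : R) : (0 <= a)%R -> (0 <= b)%R -> (0 < l < 1)%R ->
  log_comb (@tcomb R n l) l (pert_density a) (pert_density b)
    (pert_density ((1 - l) * a + l * b)).
Proof.
move=> a0 b0 l01 x y s t; rewrite /pert_density !lt_expR_expeR => xs yt.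
have := pert_comb a0 b0 l01 xs yt.
have -> : ((1 - l) * - s + l * - t = - ((1 - l) * s + l * t))%R by ring.
rewrite -lt_expR_expeR => /ltW.
by rewrite -[x in tcomb _ x _](tvecK x) -[y in tcomb _ _ y](tvecK y) -vtuple_comb vtupleK.
Qed.

Lemma pert_log_concave t : (0 <= t)%R -> log_concave (pert_density t).
Proof.
move=> t0 l l01; have := pert_density_comb t0 t0 l01.
by rewrite -mulrDl subrK mul1r.
Qed.

Definition pert_mass t : \bar R := J (fun x => expeR (- pert t x)).

(** Prekopa's theorem.  Passing to the envelope of the second function is what yields,
    around a point where it is large, the cube that [lower_envelope_log_comb]
    asks for. *)
Lemma pert_mass_log_concave (a b l : R) : (0 <= a)%R -> (0 <= b)%R -> (0 < l < 1)%R ->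
  forall s t, (expR s)%:E < pert_mass a -> (expR t)%:E < pert_mass b ->
  (expR ((1 - l) * s + l * t))%:E <= pert_mass ((1 - l) * a + l * b).
Proof.
move=> a0 b0 l01 s t sa tb.
have /andP[l0 l1] := l01.
have pos c (x : Rn) : 0 <= expeR (- pert c x) by exact: expeR_ge0.
have dpos c x : 0 <= pert_density c x by exact: expeR_ge0.
have envpos c x : 0 <= lower_envelope (pert_density c) x.
  by apply: (@lower_envelope_ge _ _ _ _ _ 1%R).
have [phi [mphi phif sphi]] := J_approx (pos a) sa.
have [psi [mpsi psif tpsi]] := J_approx (pos b) tb.
have envJ c : \int[borel_leb R n]_x lower_envelope (pert_density c) x <= pert_mass c.
  apply: J_ge => //; first exact: measurable_lower_envelope.
  by move=> x; exact: lower_envelope_le.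
apply: le_trans (envJ _).
apply: (@prekopa_leindler _ _ l phi (lower_envelope (pert_density b))) => //;
  try exact: measurable_lower_envelope.
- by move=> x; have /andP[] := phif x.
- move=> x y s' t' xs /lower_envelope_gt[d d0 yt].
  apply: (lower_envelope_log_comb (pert_density_comb a0 b0 l01) l01 d0) => //.
  by apply: lt_le_trans xs _; have /andP[] := phif x.
- apply: lt_le_trans tpsi _; apply: integral_le_lower_envelope => //.
  exact: pert_log_concave.
Qed.

(** Keep only one [w] in the infimum: [e^(- pert t x) >= e^(- t v w) e^(- u (x - t w))]. *)
Lemma pert_mass_ge (t c : R) w : (0 <= t)%R -> v w = c%:E ->
  (expR (- (t * c)))%:E * J (fun x => expeR (- u x)) <= pert_mass t.
Proof.
move=> t0 vw; have e0 : (0 < expR (t * c))%R by exact: expR_gt0.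
rewrite expRN lee_pdivrMl// leNgt; apply/negP.
move=> /(@J_approx _ _ _ _ (fun x => expeR_ge0 (- u x)))[phi [mphi phif]].
apply/negP; rewrite -leNgt -lee_pdivrMl//.
have phi0 x : 0 <= phi x by have /andP[] := phif x.
pose a := vtuple (- (t *: w))%R.
have tveca x : tvec (taffine 1 a x) = (tvec x - t *: w)%R.
  by apply/rowP => i; rewrite !mxE !tnth_mktuple mul1r !mxE.
have mphia : measurable_fun setT (phi \o taffine 1 a).
  by apply: measurableT_comp => //; exact: measurable_taffine.
have e10 : (0 <= (expR (t * c))^-1)%R by rewrite invr_ge0 ltW.
have <- : \int[borel_leb R n]_x (((expR (t * c))^-1)%:E * phi (taffine 1 a x)) =
    ((expR (t * c))^-1)%:E * \int[borel_leb R n]_x phi x.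
  rewrite ge0_integralZl//.
  by rewrite ge0_integral_taffine// invr1 expr1n mul1e.
apply: J_ge.
- exact: measurable_funeM.
- by move=> x; rewrite mule_ge0// lee_fin.
- move=> x; apply: (@le_trans _ _ (((expR (t * c))^-1)%:E * expeR (- u (tvec x - t *: w)%R))).
    rewrite lee_pmul2l ?lte_fin ?invr_gt0//.
    by have /andP[_] := phif (taffine 1 a x); rewrite tveca.
  rewrite -expRN -[(expR _)%:E]/(expeR (- (t * c))%:E) -expeRD lee_expeR.
  rewrite -[leLHS]oppeK leeN2; apply: le_trans (pert_le _ _ w) _.
  by rewrite vw oppeD ?fin_numN// EFinN oppeK addeC oppeK.
Qed.

End perturbation.

Section total_mass_finite.
Variables (R : realType) (n : nat).
Local Notation Rn := ('rV[R]_n).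
Local Notation Tn := (n.-tuple (measurableTypeR R)).

Lemma density_log_concave (u : Rn -> \bar R) : (forall x, -oo < u x) -> convex_fun u ->
  log_concave (fun s : Tn => expeR (- u (tvec s))).
Proof.
move=> uNy cu; have := pert_log_concave uNy uNy cu cu (lexx 0%R).
suff -> : @pert_density R n u u 0 = (fun s : Tn => expeR (- u (tvec s))) by [].
by apply/funext => s; rewrite /pert_density pert0.
Qed.

Lemma bounded_near_of_J_gt0 (u : Rn -> \bar R) : (forall x, -oo < u x) -> convex_fun u ->
  0 < J (fun x => expeR (- u x)) ->
  exists x0 e M, (0 < e)%R /\ forall x, (l1norm (x - x0) < e)%R -> u x < M%:E.
Proof.
move=> uNy cu /(@J_approx _ _ _ _ (fun x => expeR_ge0 (- u x)))[phi [mphi phif Iphi]].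
have [c [x0 [e [e0 cubef]]]] := log_concave_cube (density_log_concave uNy cu) mphi phif Iphi.
exists (tvec x0), e, (- c)%R; split => // x xe.
rewrite -lt_expR_expeR -[x in u x]vtupleK; apply: cubef; apply/cubeP => i.
by apply: le_lt_trans xe; rewrite (le_trans _ (le_l1norm _ i))// !mxE tnth_mktuple.
Qed.

Lemma J_lty (u : Rn -> \bar R) : classL u ->
  0 < J (fun x => expeR (- u x)) -> J (fun x => expeR (- u x)) < +oo.
Proof.
move=> [uNy _ cu uinf] /(bounded_near_of_J_gt0 uNy cu)[x0 [e [M [e0 uM]]]].
have [r [C [r0 growth]]] := convex_coercive_growth cu uNy uinf e0 uM.
pose psi (t : Tn) : \bar R := (expR C)%:E * (expR (- (l1dist (vtuple x0) t / r)))%:E.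
have mexp := measurable_exp_l1dist (vtuple x0) r.
apply: (@le_lt_trans _ _ (\int[borel_leb R n]_t psi t)).
  apply: J_le.
  - exact: measurable_funeM.
  - by move=> x; exact: expeR_ge0.
  - move=> t; rewrite /psi -EFinM -expRD -[(expR _)%:E]/(expeR (C - _)%:E) lee_expeR.
    rewrite leeNl -EFinN opprB; apply: le_trans (growth _); rewrite lee_fin.
    rewrite lerB// ler_pM2r ?invr_gt0//; apply: ler_sum => i _.
    by rewrite !mxE tnth_mktuple.
rewrite ge0_integralZl//.
rewrite lte_mul_pinfty ?lee_fin ?expR_ge0//.
exact: integral_exp_l1dist_lty.
Qed.

End total_mass_finite.

(** * One-sided derivatives of log-concave functions *)

Section limits.
Variable R : realType.

Lemma cvge_of_bounds (F : set_system R) (FF : ProperFilter F) (X : R -> \bar R) (L : \bar R) :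
  (forall r : R, r%:E < L -> \forall t \near F, r%:E <= X t) ->
  (forall r : R, L < r%:E -> \forall t \near F, X t <= r%:E) -> X t @[t --> F] --> L.
Proof.
case: L => [l| |] lo hi.
- have fin : \forall t \near F, X t \is a fin_num.
    have h1 := lo (l - 1)%R; have h2 := hi (l + 1)%R.
    near=> t; rewrite fin_numElt; apply/andP; split.
      apply: (@lt_le_trans _ _ (l - 1)%:E); first exact: ltNyr.
      by near: t; apply: h1; rewrite lte_fin ltrBlDr ltrDl.
    apply: (@le_lt_trans _ _ (l + 1)%:E); last exact: ltry.
    by near: t; apply: h2; rewrite lte_fin ltrDl.
  apply/fine_cvgP; split => //; apply/cvgrPdist_le => e e0.
  have h1 := lo (l - e)%R; have h2 := hi (l + e)%R.
  near=> t; have Xf : X t \is a fin_num by near: t.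
  rewrite ler_distlC; apply/andP; split; rewrite -lee_fin fineK//; near: t.
    by apply: h1; rewrite lte_fin ltrBlDr ltrDl.
  by apply: h2; rewrite lte_fin ltrDl.
- by apply/cvgeyPge => A; apply: lo; exact: ltry.
- by apply/cvgeNyPle => A; apply: hi; exact: ltNyr.
Unshelve. all: by end_near. Qed.

(** Elementary: [expR (s t) <= (1 - s t)^-1 <= 1 + r t] for small [t > 0]. *)
Lemma near_expR_le (s r : R) : (s < r)%R ->
  \forall t \near 0%R^'+, (expR (s * t) <= 1 + r * t)%R.
Proof.
move=> sr.
near=> t; have t0 : (0 < t)%R by near: t; exact: nbhs_right_gt.
have t1 : (t < (`|s| + 1)^-1)%R.
  by near: t; apply: nbhs_right_lt; rewrite invr_gt0 ltr_wpDl.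
have t2 : (t < (r - s) / (`|r * s| + 1))%R.
  by near: t; apply: nbhs_right_lt; rewrite divr_gt0 ?subr_gt0// ltr_wpDl.
have st1 : (s * t < 1)%R.
  apply: (@le_lt_trans _ _ (`|s| * t)%R); first by rewrite ler_pM2r// ler_norm.
  apply: (@lt_trans _ _ ((`|s| + 1) * t)%R); first by rewrite ltr_pM2r// ltrDl.
  by rewrite mulrC -ltr_pdivlMr ?ltr_wpDl// div1r.
have rst : (r * s * t <= r - s)%R.
  apply: (@le_trans _ _ (`|r * s| * t)%R); first by rewrite ler_pM2r// ler_norm.
  apply: (@le_trans _ _ ((`|r * s| + 1) * t)%R); first by rewrite ler_pM2r// lerDl.
  by rewrite mulrC -ler_pdivlMr ?ltr_wpDl// ltW.
have H1 := expR_ge1Dx (- (s * t))%R.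
have P1 : (0 < 1 - s * t)%R by rewrite subr_gt0.
rewrite -[(s * t)%R]opprK expRN.
apply: (@le_trans _ _ (1 - s * t)^-1%R); first by rewrite lef_pV2 ?posrE ?expR_gt0.
rewrite -div1r ler_pdivrMr//.
have : (0 <= t * (r - s - r * s * t))%R by rewrite mulr_ge0 ?(ltW t0)// subr_ge0.
rewrite (_ : (1 + r * t) * (1 - s * t) = 1 + t * (r - s - r * s * t))%R; last by ring.
lra.
Unshelve. all: by end_near. Qed.

(** The limit of the slopes at 0 of [ln j] is the supremum [L] of the [s] such that
    [e^(s t) j0 < j t] for some [t > 0].  By log-concavity such an [s] remains a lower
    slope at all smaller times, so [s j0] is eventually below the quotient; and
    for [s > L], [j t <= e^(s t) j0] for all [t]. *)
Lemma log_concave_right_derivative (j : R -> \bar R) (j0 c0 : R) : (0 < j0)%R ->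
  (forall t, (0 < t)%R -> (expR (- (t * c0)))%:E * j0%:E <= j t) ->
  (forall s t, (0 < s)%R -> (s < t)%R -> forall a b, (expR a < j0)%R -> (expR b)%:E < j t ->
    (expR ((1 - s / t) * a + s / t * b))%:E <= j s) ->
  exists L, (forall c, (forall t, (0 < t)%R -> (expR (- (t * c)))%:E * j0%:E <= j t) ->
    (- c)%:E <= L) /\ (j t - j0%:E) * (t^-1)%:E @[t --> 0%R^'+] --> L * j0%:E.
Proof.
move=> j00 jge jlc.
pose S := [set s : R | exists2 t, (0 < t)%R & (expR (s * t) * j0)%:E < j t].
pose L := ereal_sup (EFin @` S).
have Lge c : (forall t, (0 < t)%R -> (expR (- (t * c)))%:E * j0%:E <= j t) -> (- c)%:E <= L.
  move=> jc; apply/lee_subgt0Pr => e e0; rewrite -EFinB.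
  apply: ereal_sup_ubound; exists (- c - e)%R => //; exists 1%R => //.
  apply: lt_le_trans (jc _ ltr01); rewrite -EFinM lte_fin ltr_pM2r// ltr_expR; lra.
have LNy : L != -oo by rewrite gt_eqF// (lt_le_trans _ (Lge _ jge))// ltNyr.
exists L; split => //.
have slope s t0 : (0 < t0)%R -> (expR (s * t0) * j0)%:E < j t0 ->
    forall t, (0 < t)%R -> (t < t0)%R -> (expR (s * t) * j0)%:E <= j t.
  move=> t00 st0 t tp tt0.
  have l0 : (0 < t / t0)%R by rewrite divr_gt0.
  have l1 : (t / t0 < 1)%R by rewrite ltr_pdivrMr// mul1r.
  have j0E : j0 = expR (ln j0) by rewrite lnK.
  rewrite j0E -expRD; apply: le_of_expR_lt; last first.
    by apply: le_trans (jge _ tp); rewrite -EFinM lee_fin mulr_ge0 ?expR_ge0// ltW.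
  move=> a; rewrite lte_fin ltr_expR => ha.
  pose d := ((s * t + ln j0 - a) / (1 - t / t0))%R.
  have d0 : (0 < d)%R by rewrite divr_gt0// subr_gt0.
  have lo : (expR (ln j0 - d) < j0)%R by rewrite [ltRHS]j0E ltr_expR ltrBlDr ltrDl.
  have hi : (expR (s * t0 + ln j0))%:E < j t0 by rewrite expRD -j0E.
  have := jlc t t0 tp tt0 _ _ lo hi.
  rewrite (_ : (1 - t / t0) * _ + _ = a)%R// mulrBr /d.
  rewrite [((1 - t / t0) * (_ / _))%R]mulrC divfK; last by rewrite gt_eqF// subr_gt0.
  by rewrite mulrDr mulrCA divfK ?gt_eqF//; ring.
apply: cvge_of_bounds.
- move=> r rL.
  have [s [t0 t00 st0] rs] : exists2 s, S s & (r < s * j0)%R.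
    have : (r / j0)%:E < L by rewrite EFinM lte_pdivrMr.
    by move=> /ereal_sup_gt[_ [s Ss <-]]; rewrite lte_fin ltr_pdivrMr//; exists s.
  near=> t; have tp : (0 < t)%R by near: t; exact: nbhs_right_gt.
  have tt0 : (t < t0)%R by near: t; exact: nbhs_right_lt.
  have jt := slope s t0 t00 st0 t tp tt0.
  rewrite lee_pdivlMr// leeBrDr// -EFinM -EFinD; apply: le_trans jt; rewrite lee_fin.
  have := expR_ge1Dx (s * t)%R => H.
  apply: (@le_trans _ _ ((1 + s * t) * j0)%R); last by rewrite ler_pM2r.
  have : (r * t <= s * j0 * t)%R by rewrite ler_pM2r// ltW.
  lra.
- move=> r Lr.
  have [s sr Ls] : exists2 s, (s < r / j0)%R & L < s%:E.
    have : L < (r / j0)%:E by rewrite EFinM lte_pdivlMr.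
    case: (L) LNy => // l _; rewrite lte_fin => lr.
    by exists ((l + r / j0) / 2)%R; rewrite ?lte_fin midf_lt.
  have js t : (0 < t)%R -> j t <= (expR (s * t) * j0)%:E.
    move=> tp; rewrite leNgt; apply/negP => H; move: Ls; apply/negP; rewrite -leNgt.
    by apply: ereal_sup_ubound; exists s => //; exists t.
  near=> t; have tp : (0 < t)%R by near: t; exact: nbhs_right_gt.
  rewrite lee_pdivrMr// leeBlDr//; apply: le_trans (js _ tp) _; rewrite -EFinM -EFinD lee_fin.
  have : (expR (s * t) <= 1 + r / j0 * t)%R by near: t; exact: near_expR_le.
  move=> /(ler_wpM2r (ltW j00))/le_trans; apply.
  by rewrite mulrDl mul1r mulrAC divfK ?gt_eqF// addrC.
Unshelve. all: by end_near. Qed.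

End limits.

(** * Functions of zero mass on the line *)

Section dimension_one.
Variable R : realType.
Local Notation mR := (measurableTypeR R).
Local Notation leb := (@lebesgue_measure R).
Local Notation R1 := ('rV[R]_1).
Local Notation T1 := (1.-tuple mR).
Implicit Types u v w : R1 -> \bar R.

Definition segment (i : interval R) : set T1 := rect (fun=> [set` i]).

Lemma measurable_segment i : measurable (segment i).
Proof. by apply: measurable_rect => j; exact: measurable_itv. Qed.

Lemma integral_segment i (c : R) : (0 <= c)%R ->
  \int[borel_leb R 1]_t (c * \1_(segment i) t)%:E = c%:E * leb [set` i].
Proof.
move=> c0; under eq_integral do rewrite EFinM.
have ms := measurable_segment i.
rewrite ge0_integralZl//=; last exact/measurable_EFinP/measurable_indic.
rewrite integral_indic// setIT; congr (_ * _).
have := @borel_rect R 1 (fun=> [set` i]) (fun=> measurable_itv i).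
by rewrite big_ord1.
Qed.

Lemma measurable_segment_fun i (c : R) :
  measurable_fun setT (fun t : T1 => (c * \1_(segment i) t)%:E : \bar R).
Proof.
apply/measurable_EFinP/measurable_funM => //.
by apply: measurable_indic; exact: measurable_segment.
Qed.

Lemma J_segment_ge w (a b c : R) : (a < b)%R ->
  (forall x : R1, (a < x ord0 ord0 < b)%R -> w x <= c%:E) ->
  (expR (- c) * (b - a))%:E <= J (fun x => expeR (- w x)).
Proof.
move=> ab wc.
have <- : \int[borel_leb R 1]_t (expR (- c) * \1_(segment `]a, b[) t)%:E = (expR (- c) * (b - a))%:E.
  by rewrite integral_segment ?expR_ge0// lebesgue_measure_itv/= lte_fin ab -EFinB EFinM.
apply: J_ge.
- exact: measurable_segment_fun.
- by move=> t; rewrite lee_fin mulr_ge0 ?expR_ge0// indicE ler0n.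
- move=> t; rewrite indicE; have [tab|nt] := pselect (segment `]a, b[ t); last first.
    by rewrite memNset// mulr0 expeR_ge0.
  rewrite mem_set// mulr1 -[(expR _)%:E]/(expeR (- c)%:E) lee_expeR EFinN leeN2.
  by apply: wc; have := tab ord0; rewrite /= in_itv/= mxE.
Qed.

Lemma J_segment_le w (a b c : R) : (a <= b)%R ->
  (forall x, c%:E <= w x) -> (forall x : R1, w x < +oo -> (a <= x ord0 ord0 <= b)%R) ->
  J (fun x => expeR (- w x)) <= (expR (- c) * (b - a))%:E.
Proof.
move=> ab wc wab.
have <- : \int[borel_leb R 1]_t (expR (- c) * \1_(segment `[a, b]) t)%:E = (expR (- c) * (b - a))%:E.
  rewrite integral_segment ?expR_ge0// lebesgue_measure_itv/= lte_fin EFinM; congr (_ * _).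
  by case: ltP => [_|ba]; [rewrite -EFinB|congr EFin; apply/esym/eqP; rewrite subr_eq0 eq_le ab ba].
apply: J_le.
- exact: measurable_segment_fun.
- by move=> x; exact: expeR_ge0.
- move=> t; have [wy|] := ltP (w (tvec t)) +oo; last first.
    rewrite leye_eq => /eqP ->; rewrite /= lee_fin mulr_ge0 ?expR_ge0// indicE ler0n//.
  have tab : segment `[a, b] t.
    by move=> i; have := wab _ wy; rewrite (ord1 i) mxE /= in_itv.
  rewrite indicE mem_set// mulr1 -[(expR _)%:E]/(expeR (- c)%:E) lee_expeR EFinN leeN2.
  exact: wc.
Qed.

Lemma convex_le_segment v (x y : R1) (M : R) : convex_fun v ->
  v x <= M%:E -> v y <= M%:E -> (x ord0 ord0 < y ord0 ord0)%R ->
  forall z : R1, (x ord0 ord0 < z ord0 ord0 < y ord0 ord0)%R -> v z <= M%:E.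
Proof.
move=> cv vx vy xy z /andP[xz zy].
pose a := ((y ord0 ord0 - z ord0 ord0) / (y ord0 ord0 - x ord0 ord0))%R.
have d0 : (0 < y ord0 ord0 - x ord0 ord0)%R by rewrite subr_gt0.
have a01 : (0 < a < 1)%R.
  by rewrite divr_gt0 ?subr_gt0//= ltr_pdivrMr// mul1r; lra.
have -> : z = (a *: x + (1 - a) *: y)%R.
  apply/rowP => i; rewrite (ord1 i) !mxE /a; field; rewrite gt_eqF//.
apply: le_trans (cv _ _ _ a01) _.
have /andP[a0 a1] := a01.
rewrite [leRHS](_ : _ = (a * M)%:E + ((1 - a) * M)%:E); last first.
  by rewrite -EFinD -mulrDl subrKC mul1r.
by rewrite (EFinM a) (EFinM (1 - a)%R); apply: leeD; rewrite lee_pmul2l ?lte_fin ?subr_gt0.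
Qed.

(** Two points in the domain would bound [u] from above on a segment, giving positive
    mass. *)
Lemma dom_singleton u x0 x : convex_fun u -> u x0 \is a fin_num ->
  J (fun x => expeR (- u x)) = 0 -> u x \is a fin_num -> x = x0.
Proof.
move=> cu u0 J0 ux.
have main (y z : R1) : u y \is a fin_num -> u z \is a fin_num ->
    (y ord0 ord0 < z ord0 ord0)%R -> False.
  move=> uy uz yz.
  pose M := Num.max (fine (u y)) (fine (u z)).
  have uM : u y <= M%:E /\ u z <= M%:E.
    by rewrite -(fineK uy) -(fineK uz) !lee_fin !le_max !lexx orbT.
  have := J_segment_ge yz (convex_le_segment cu uM.1 uM.2 yz).
  rewrite J0 lee_fin leNgt; apply/negP; rewrite negbK.
  by rewrite mulr_gt0 ?expR_gt0// subr_gt0.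
apply/rowP => i; rewrite (ord1 i).
by case: (ltgtP (x ord0 ord0) (x0 ord0 ord0)) => // h; [case: (main x x0)|case: (main x0 x)].
Qed.

(** The limit is [e^(- u x0) * l], where [l] is the length of the domain of [v].  Below:
    [v] is bounded above between two points [a < b] of its domain, so the mass
    is at least [e^(- u x0 - t M) t (b - a)].  Above, if [l] is finite: [v] is bounded
    below by some [m], so the mass is at most [e^(- u x0 - t m) t l]. *)
Lemma null_mass_limit u v (x0 : R1) : classL u -> classL v -> u x0 \is a fin_num ->
  J (fun x => expeR (- u x)) = 0 ->
  exists2 L, 0 <= L & pert_mass u v t * (t^-1)%:E @[t --> 0%R^'+] --> L.
Proof.
move=> [uNy _ cu _] [vNy [w0 vw0] cv _] u0 J0.
have vw0f : v w0 \is a fin_num by [].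
have single x : x != x0 -> u x = +oo.
  move=> xx0; apply/eqP; rewrite -leye_eq leNgt; apply/negP => uxy.
  have uxf : u x \is a fin_num by rewrite fin_numE gt_eqF ?uNy// lt_eqF.
  by move/eqP: xx0; apply; exact: dom_singleton uxf.
pose D := [set w ord0 ord0 | w in [set w | v w \is a fin_num]].
pose l := ereal_sup [set (p.2 - p.1)%:E | p in D `*` D].
pose e0 := expR (- fine (u x0)).
have e00 : (0 < e0)%R by exact: expR_gt0.
have D0 : D (w0 ord0 ord0) by exists w0.
have l0 : 0 <= l.
  by apply: ereal_sup_ubound; exists (w0 ord0 ord0, w0 ord0 ord0) => //=; rewrite subrr.
have mass0 t : 0 <= pert_mass u v t by apply: J_ge0 => x; exact: expeR_ge0.
exists (e0%:E * l); first by rewrite mule_ge0// lee_fin ltW.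
apply: cvge_of_bounds => r rl.
- have : (e0^-1 * r)%:E < l by rewrite EFinM lte_pdivrMl.
  move=> /ereal_sup_gt[_ [[a b] /= [[wa vwa aE] [wb vwb bE]] <-]].
  rewrite lte_fin mulrC ltr_pdivrMr// => rab.
  have [ab|ba] := ltP a b; last first.
    near=> t; have tp : (0 < t)%R by near: t; exact: nbhs_right_gt.
    apply: (@le_trans _ _ 0); last by rewrite mule_ge0// lee_fin invr_ge0 ltW.
    rewrite lee_fin (le_trans (ltW rab))// mulr_le0_ge0 ?subr_le0// ltW//.
  pose M := Num.max (fine (v wa)) (fine (v wb)).
  have vM : v wa <= M%:E /\ v wb <= M%:E.
    by rewrite -(fineK vwa) -(fineK vwb) !lee_fin !le_max !lexx orbT.
  pose K := ((b - a) * e0)%R.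
  near=> t; have tp : (0 < t)%R by near: t; exact: nbhs_right_gt.
  have tK : (t < (K - r) / (`|M * K| + 1))%R.
    by near: t; apply: nbhs_right_lt; rewrite divr_gt0 ?subr_gt0// ltr_wpDl.
  have tMK : (t * (M * K) <= K - r)%R.
    apply: (@le_trans _ _ (t * (`|M * K| + 1))%R).
      by rewrite ler_pM2l// (le_trans (ler_norm _))// lerDl.
    by rewrite -ler_pdivlMr ?ltr_wpDl// ltW.
  have mass : (expR (- (fine (u x0) + t * M)) * (t * b - t * a))%:E <= pert_mass u v t.
    have -> : (t * b - t * a = (x0 ord0 ord0 + t * b) - (x0 ord0 ord0 + t * a))%R by ring.
    apply: J_segment_ge; first by rewrite ltrD2l ltr_pM2l.
    move=> x /andP[xa xb]; pose w : R1 := (t^-1 *: (x - x0))%R.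
    have wE : w ord0 ord0 = (t^-1 * (x ord0 ord0 - x0 ord0 ord0))%R by rewrite !mxE.
    apply: (le_trans (pert_le _ _ _ _ w)).
    rewrite /w scalerA divff ?gt_eqF// scale1r opprB subrKC -/w.
    rewrite -{1}(fineK u0) EFinD EFinM leeD2l// lee_pmul2l//.
    apply: (convex_le_segment cv vM.1 vM.2); first by rewrite aE bE.
    by rewrite aE bE wE mulrC ltr_pdivlMr// ltr_pdivrMr//; lra.
  rewrite lee_pdivlMr//; apply: le_trans mass; rewrite -EFinM lee_fin.
  rewrite opprD expRD -/e0 -mulrBr.
  have H := expR_ge1Dx (- (t * M))%R.
  apply: (@le_trans _ _ (e0 * (1 - t * M) * (t * (b - a)))%R); last first.
    by rewrite ler_pM2r ?mulr_gt0 ?subr_gt0// ler_pM2l.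
  rewrite [leRHS](_ : _ = (K - t * (M * K)) * t)%R; last by rewrite /K; ring.
  by rewrite ler_pM2r//; lra.
- have lf : l \is a fin_num.
    rewrite ge0_fin_numE// ltey; apply/eqP => ly; move: rl.
    by rewrite ly gt0_muley ?lte_fin// ltNge leey.
  set d := fine l; have lE : l = d%:E by rewrite fineK.
  have Dd a b : D a -> D b -> (b - a <= d)%R.
    by move=> Da Db; rewrite -lee_fin -lE; apply: ereal_sup_ubound; exists (a, b).
  have d0 : (0 <= d)%R by rewrite -lee_fin -lE.
  (* a convex function is bounded below on its bounded domain, unless the domain
     is a point, where it is obvious *)
  have [m vm] : exists m : R, forall w : R1, m%:E <= v w.
    have [[a [b [[wa vwa aE] [wb vwb bE] ab]]]|nD] :=
      pselect (exists a b, [/\ D a, D b & (a < b)%R]).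
      pose M := Num.max (fine (v wa)) (fine (v wb)).
      have vM : v wa <= M%:E /\ v wb <= M%:E.
        by rewrite -(fineK vwa) -(fineK vwb) !lee_fin !le_max !lexx orbT.
      have e0' : (0 < (b - a) / 2)%R by rewrite divr_gt0// subr_gt0.
      pose mid : R1 := (const_mx ((a + b) / 2))%R.
      have l1E (x : R1) : l1norm (x - mid)%R = `|x ord0 ord0 - (a + b) / 2|%R.
        by rewrite /l1norm big_ord1 !mxE.
      have [A [B [B0 lb]]] : exists A B : R, (0 <= B)%R /\
          forall y, (A - B * l1norm (y - mid))%:E <= v y.
        apply: (convex_lower_bound (M := (M + 1)%R) cv vNy e0') => x.
        rewrite l1E ltr_distlC => /andP[h1 h2].
        apply: (@le_lt_trans _ _ M%:E); last by rewrite lte_fin ltrDl.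
        by apply: (convex_le_segment cv vM.1 vM.2); rewrite aE bE//; lra.
      exists (A - B * d)%R => w.
      have [vwy|] := ltP (v w) +oo; last by rewrite leye_eq => /eqP ->; exact: leey.
      have Dw : D (w ord0 ord0) by exists w => //=; rewrite fin_numE gt_eqF ?vNy// lt_eqF.
      apply: le_trans (lb w); rewrite lee_fin lerB// ler_wpM2l// l1E.
      have Da : D a by exists wa. have Db : D b by exists wb.
      have := Dd _ _ Da Dw; have := Dd _ _ Dw Db; rewrite ler_norml; lra.
    exists (fine (v w0)) => w; rewrite fineK//.
    have [vwy|] := ltP (v w) +oo; last by rewrite leye_eq => /eqP ->; exact: leey.
    have Dw : D (w ord0 ord0) by exists w => //=; rewrite fin_numE gt_eqF ?vNy// lt_eqF.
    suff -> : w = w0 by [].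
    apply/rowP => i; rewrite (ord1 i).
    case: (ltgtP (w ord0 ord0) (w0 ord0 ord0)) => // h; exfalso; apply: nD.
      by exists (w ord0 ord0), (w0 ord0 ord0).
    by exists (w0 ord0 ord0), (w ord0 ord0).
  have Dub : has_ubound D.
    by exists (w0 ord0 ord0 + d)%R => b Db; rewrite -lerBlDl; exact: Dd.
  have Dlb : has_lbound D.
    by exists (w0 ord0 ord0 - d)%R => a Da; rewrite lerBlDr -lerBlDl; exact: Dd.
  pose p := inf D; pose q := sup D.
  have pq : (p <= q)%R.
    by apply: (@le_trans _ _ (w0 ord0 ord0)); [exact: ge_inf|exact: ub_le_sup].
  have qpd : (q - p <= d)%R.
    rewrite lerBlDr; apply: ge_sup; first by exists (w0 ord0 ord0).
    move=> b Db; rewrite -lerBlDl; apply: lb_le_inf; first by exists (w0 ord0 ord0).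
    by move=> a Da; rewrite lerBlDr -lerBlDl; exact: Dd.
  have e0d : (e0 * d < r)%R by move: rl; rewrite lE -EFinM lte_fin.
  pose rho := (`|m| + 1)%R.
  have mrho : (- m < rho)%R.
    by rewrite /rho; apply: (@le_lt_trans _ _ `|m|%R); rewrite ?ltrDl// -normrN ler_norm.
  have rho0 : (0 < rho)%R by rewrite ltr_wpDl.
  near=> t; have tp : (0 < t)%R by near: t; exact: nbhs_right_gt.
  have tr : (t < (r - e0 * d) / (e0 * d * rho + 1))%R.
    near: t; apply: nbhs_right_lt; rewrite divr_gt0 ?subr_gt0// ltr_wpDl//.
    by rewrite !mulr_ge0// ltW.
  have tm : (expR (- m * t) <= 1 + rho * t)%R by near: t; exact: near_expR_le.
  have fin_at x (w : R1) : u (x - t *: w)%R + t%:E * v w < +oo -> x = (x0 + t *: w)%R /\ v w \is a fin_num.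
    have vNy' : t%:E * v w != -oo.
      by have := vNy w; case: (v w) => // _; rewrite gt0_muley.
    have [E|nx] := eqVneq (x - t *: w)%R x0; last by rewrite (single _ nx) addye ?ltxx.
    rewrite E => h; split; first by rewrite -E subrK.
    rewrite fin_numE gt_eqF ?vNy//=; apply/eqP => vwy; move: h.
    by rewrite vwy gt0_muley ?lte_fin// addey ?ltxx// -ltNye uNy.
  have mass : pert_mass u v t <= (expR (- (fine (u x0) + t * m)) * (t * q - t * p))%:E.
    have -> : (t * q - t * p = (x0 ord0 ord0 + t * q) - (x0 ord0 ord0 + t * p))%R by ring.
    apply: J_segment_le.
    - by rewrite lerD2l ler_pM2l.
    - move=> x; apply: le_ereal_inf_tmp => _ [w _ <-].
      have [fin|] := ltP (u (x - t *: w)%R + t%:E * v w) +oo; last first.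
        by rewrite leye_eq => /eqP ->; exact: leey.
      have [xE _] := fin_at _ _ fin.
      rewrite xE addrK -{2}(fineK u0) EFinD leeD2l// EFinM lee_pmul2l//.
    - move=> x /pert_lt[w /fin_at[-> vwf]]; rewrite !mxE lerD2l lerD2l !ler_pM2l//.
      by rewrite ge_inf ?ub_le_sup//; exists w.
  rewrite lee_pdivrMr//; apply: (le_trans mass); rewrite -EFinM lee_fin.
  rewrite opprD expRD -/e0 -mulrBr -mulrN mulrC.
  rewrite (mulrC t (- m)%R).
  apply: (@le_trans _ _ (t * d * (e0 * (1 + rho * t)))%R).
    apply: ler_pM.
    - by rewrite mulr_ge0 ?(ltW tp)// subr_ge0.
    - by rewrite mulr_ge0 ?expR_ge0// ltW.
    - by rewrite ler_pM2l.
    - by rewrite ler_pM2l.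
  rewrite [leLHS](_ : _ = (e0 * d + t * (e0 * d * rho)) * t)%R; last by ring.
  rewrite ler_pM2r// -lerBrDl.
  have edr : (0 <= e0 * d * rho)%R by rewrite !mulr_ge0// ltW.
  apply: (@le_trans _ _ (t * (e0 * d * rho + 1))%R); first by rewrite ler_pM2l// lerDl.
  by rewrite -ler_pdivlMr ?ltr_wpDl// ltW.
Unshelve. all: by end_near. Qed.

End dimension_one.

(** * The first variation *)

Section first_variation.
Variables (R : realType) (n : nat).
Local Notation Rn := ('rV[R]_n).
Implicit Types u v : Rn -> \bar R.

Lemma neglog_expeR u : neglog (fun x => expeR (- u x)) = u.
Proof. by apply/funext => x; rewrite /neglog expeRK oppeK. Qed.

Lemma infconv_rscale u v (t : R) : (0 < t)%R -> infconv u (rscale v t) = pert u v t.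
Proof.
move=> t0; apply/funext => x; rewrite /infconv /pert /rscale gt_eqF//.
congr ereal_inf; apply/seteqP; split => [_ [y _ <-]|_ [w _ <-]].
  by exists (t^-1 *: y)%R => //; rewrite scalerA divff ?gt_eqF// scale1r.
by exists (t *: w)%R => //; rewrite scalerA mulVf ?gt_eqF// scale1r.
Qed.

Lemma J_oplus u v (t : R) : (0 < t)%R ->
  J (oplus (fun x => expeR (- u x)) t (fun x => expeR (- v x))) = pert_mass u v t.
Proof. by move=> t0; rewrite /oplus !neglog_expeR infconv_rscale. Qed.

(** [- v w <= L] because [e^(- t v w) * J f] minorizes the mass for every [w]. *)
Lemma first_variation_cvg u v : classL u -> classL v ->
  0 < J (fun x => expeR (- u x)) ->
  exists L, (forall w (c : R), v w = c%:E -> (- c)%:E <= L) /\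
    (pert_mass u v t - J (fun x => expeR (- u x))) * (t^-1)%:E @[t --> 0%R^'+] -->
      L * J (fun x => expeR (- u x)).
Proof.
move=> uL vL J0; have Jy := J_lty uL J0.
have [uNy _ cu _] := uL; have [vNy [w0 vw0] cv _] := vL.
have Jf : J (fun x => expeR (- u x)) \is a fin_num by rewrite ge0_fin_numE// ltW.
have JE := fineK Jf; rewrite -JE; set j0 := fine _ in JE *.
have j00 : (0 < j0)%R by rewrite -lte_fin JE.
have ge c w : v w = c%:E -> forall t, (0 < t)%R ->
    (expR (- (t * c)))%:E * j0%:E <= pert_mass u v t.
  by move=> vw t t0; rewrite JE; apply: (pert_mass_ge u (ltW t0) vw).
have vw0E : v w0 = (fine (v w0))%:E by rewrite fineK.
have lc s t : (0 < s)%R -> (s < t)%R -> forall a b, (expR a < j0)%R ->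
    (expR b)%:E < pert_mass u v t ->
    (expR ((1 - s / t) * a + s / t * b))%:E <= pert_mass u v s.
  move=> s0 st a b aj bj.
  have t0 : (0 < t)%R by exact: lt_trans st.
  have l01 : (0 < s / t < 1)%R by rewrite divr_gt0//= ltr_pdivrMr// mul1r.
  have E : ((1 - s / t) * 0 + s / t * t = s)%R by rewrite mulr0 add0r divfK// gt_eqF.
  rewrite -[X in pert_mass u v X]E.
  apply: pert_mass_log_concave => //; first exact: ltW.
  rewrite /pert_mass; under [X in J X]eq_fun do rewrite pert0.
  by rewrite -JE lte_fin.
have [L [Lge Lcvg]] := log_concave_right_derivative j00 (ge _ _ vw0E) lc.
exists L; split => // w c vw; apply: Lge => t t0; exact: ge vw _ t0.
Qed.

End first_variation.

Theorem theorem3p6 (R : realType) (n : nat) (hn : (1 <= n)%N)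
  (f g : 'rV[R]_n -> \bar R) (hf : classA f) (hg : classA g)
  (hJ : 0 < J f \/ n = 1%N) :
  J_differentiable f g /\ deltaJ f g \in `[- kJ f g, +oo].
Proof.
move: hf hg => [u uL fE] [v vL gE]; subst f g.
set f := fun x => expeR (- u x) in hJ *; set g := fun x => expeR (- v x).
have J0 : 0 <= J f by apply: J_ge0 => x; exact: expeR_ge0.
suff [L Lcvg Lge] : exists2 L, J_quotient f g t @[t --> 0%R^'+] --> L & - kJ f g <= L.
  split; first by apply/cvg_ex; exists L.
  by rewrite /deltaJ (cvg_lim (@ereal_hausdorff R) Lcvg) in_itv/= Lge leey.
(* [J_oplus] holds for [t > 0] only, so the two quotients agree near 0 on the right *)
have quotE : {near 0%R^'+, (fun t => (pert_mass u v t - J f) * (t^-1)%:E) =1 J_quotient f g}.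
  near=> t; have t0 : (0 < t)%R by near: t; exact: nbhs_right_gt.
  by rewrite /J_quotient J_oplus.
have [vNy _ _ _] := vL.
have kE : kJ f g = maxe (ereal_inf (range v)) 0 * J f by rewrite /kJ neglog_expeR.
rewrite kE; have [JE|Jneq] := eqVneq (J f) 0.
  case: hJ => [|n1]; first by rewrite JE ltxx.
  subst n; have [_ [x0 ux0] _ _] := uL.
  have [L L0 Lcvg] := null_mass_limit uL vL ux0 JE.
  exists L; last by rewrite JE mule0 oppe0.
  apply: cvg_trans Lcvg; apply: near_eq_cvg.
  by apply: filterS quotE => t <-; rewrite JE sube0.
have Jpos : 0 < J f by rewrite lt_neqAle eq_sym Jneq.
have [L [Lge Lcvg]] := first_variation_cvg uL vL Jpos.
exists (L * J f); first by apply: cvg_trans Lcvg; exact: near_eq_cvg.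
rewrite leeNl -mulNe; apply: lee_wpmul2r => //.
rewrite le_max; apply/orP; left; apply: le_ereal_inf_tmp => _ [w _ <-].
case vw : (v w) => [c| |]; first by rewrite leeNl -EFinN; exact: Lge vw.
  exact: leey.
by have := vNy w; rewrite vw.
Unshelve. all: by end_near. Qed.
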